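(* Let $U,V,W\in \mathrm{Gr}(n)$ be distinct, with $\dim U=r$, $\dim V=p$, $\dim W=q$. Then $U\in(V,W)_{d_{\mathrm{g}}}$ if and only if at least one of the following holds: (i) $p\leq r\leq q$, $U=U'\boxplus R$ and $W=W'\boxplus T$ for some subspaces $U',W',R,T$ with $V,U',W'\in \mathrm{Gr}_p(T^\perp)$, $R\subset T$ and $U'\in[V,W']_{d_{\mathrm{g}}}$; or (ii) $U\subset W$, with $V\perp W$ or $p>q$.
   Context: $\mathbb{F}=\mathbb{R}$ or $\mathbb{C}$, $\mathbb{F}^n$ has its canonical inner product (Hermitian if $\mathbb{F}=\mathbb{C}$), $\mathrm{Gr}(n)$ is the set of all subspaces of $\mathbb{F}^n$, $\mathrm{Gr}_p(X)$ is the set of $p$-dimensional subspaces of $X$; $V_{(p)}$ indicates $\dim V=p$; $\subset$ allows equality; $\boxplus$ denotes the orthogonal direct sum of subspaces. Principal angles of $V_{(p)},W_{(q)}$ with $m=\min\{p,q\}\neq0$: $0\leq\theta_1\leq\cdots\leq\theta_m\leq\frac\pi2$, $\theta_i=\cos^{-1}\sigma_i$, where $\sigma_1\geq\cdots\geq\sigma_m$ are the singular values of the orthogonal projection $V\to W$. For $V_{(p)},W_{(q)}$, the asymmetric geodesic metric is $d_{\mathrm{g}}(V,W)=0$ if $p=0$, $\sqrt{\sum_{i=1}^p\theta_i^2}$ if $0<p\leq q$, and $\frac\pi2\sqrt p$ if $p>q$. $[V,W]_{d_{\mathrm g}}=\{U\in \mathrm{Gr}(n): d_{\mathrm g}(V,W)=d_{\mathrm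 g}(V,U)+d_{\mathrm g}(U,W)\}$ and $(V,W)_{d_{\mathrm g}}=[V,W]_{d_{\mathrm g}}\setminus\{V,W\}$. *)

(* Defs.v *)
From HB Require Import structures.
From mathcomp Require Import all_boot all_order all_algebra.
From mathcomp Require Import sesquilinear.
From mathcomp Require Import complex.
From mathcomp Require Import boolp classical_sets reals trigo.

Set Implicit Arguments.
Unset Strict Implicit.
Unset Printing Implicit Defensive.

Import Order.TTheory GRing.Theory Num.Theory.
Local Open Scope ring_scope.

Inductive scalar_kind := RealScalars | ComplexScalars.

Definition scalar_field (R : realType) (k : scalar_kind) : numFieldType :=
  match k with
  | RealScalars => R
  | ComplexScalars => R[i]
  end.

Definition scalar_conj (R : realType) (k : scalar_kind) :
    involutive_rmorphism (scalar_field R k) :=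
  match k return involutive_rmorphism (scalar_field R k) with
  | RealScalars => (idfun : R -> R)
  | ComplexScalars => (Num.conj : R[i] -> R[i])
  end.

Definition scalar_of_real (R : realType) (k : scalar_kind) :
    R -> scalar_field R k :=
  match k return R -> scalar_field R k with
  | RealScalars => fun x => x
  | ComplexScalars => real_complex R
  end.

Section Grassmannian.
Variables (R : realType) (k : scalar_kind) (n : nat).

Local Notation F := (scalar_field R k).
Local Notation conj := (scalar_conj R k).
Local Notation Gr := {vspace 'rV[F]_n}.

Definition inner (u v : 'rV[F]_n) : F := \sum_(i < n) u 0 i * conj (v 0 i).

Fact inner_is_linearl (v : 'rV[F]_n) : linear_for *%R (inner^~ v).
Proof.
move=> a u1 u2; rewrite /inner mulr_sumr -big_split; apply: eq_bigr => i _ /=.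
by rewrite !mxE mulrDl mulrA.
Qed.

Fact inner_is_linearr (u : 'rV[F]_n) : linear_for (conj \; *%R) (inner u).
Proof.
move=> a v1 v2; rewrite /inner /= mulr_sumr -big_split; apply: eq_bigr => i _ /=.
by rewrite !mxE rmorphD rmorphM mulrDr mulrCA.
Qed.

HB.instance Definition _ := bilinear_isBilinear.Build F 'rV[F]_n 'rV[F]_n F
  *%R (conj \; *%R) inner (inner_is_linearl, inner_is_linearr).

Fact inner_is_hermitian (u v : 'rV[F]_n) :
  inner u v = (-1) ^+ false * conj (inner v u).
Proof.
rewrite expr0 mul1r /inner rmorph_sum; apply: eq_bigr => i _ /=.
by rewrite rmorphM mulrC; congr (_ * _); exact/esym/rmorphK.
Qed.

HB.instance Definition _ := isHermitianSesquilinear.Build F 'rV[F]_n false conj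
  inner inner_is_hermitian.

Definition orthocompl (V : Gr) : Gr := orthov inner V.

Definition orthosub (V W : Gr) : bool := (V <= orthocompl W)%VS.

Definition is_orthosum (U A B : Gr) : Prop := U = (A + B)%VS /\ orthosub A B.

Definition Grp (p : nat) (X : Gr) : set Gr :=
  [set V : Gr | \dim V = p /\ (V <= X)%VS]%classic.

Definition orthoproj (W : Gr) : 'End('rV[F]_n) := daddv_pi W (orthocompl W).

(* Singular value decomposition of a linear map [V -> W] given by an
   endomorphism [f] of the ambient space with [f @: V <= W].  Since [s`_i = 0]
   for [size s <= i], the last clause also says that [f] kills the basis vectors
   of [V] of index at least [minn (\dim V) (\dim W)]. *)
Definition singular_values_of (f : 'End('rV[F]_n)) (V W : Gr) (s : seq R) :
    Prop :=
  [/\ size s = minn (\dim V) (\dim W),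
      sorted >=%R s,
      all (>= 0) s
    & exists e g : seq 'rV[F]_n,
        [/\ basis_of V e, orthonormal inner e,
            basis_of W g, orthonormal inner g
          & forall i, (i < \dim V)%N ->
              f e`_i = scalar_of_real k s`_i *: g`_i]].

(* [singular_values_of (orthoproj W) V W] is satisfied by exactly one sequence,
   so [xget] picks it and the default [[::]] is never used. *)
Definition principal_angles (V W : Gr) : seq R :=
  [seq acos x | x <-
     xget [::] [set s | singular_values_of (orthoproj W) V W s]%classic].

(* Asymmetric: [dg V W] and [dg W V] differ in general. *)
Definition dg (V W : Gr) : R :=
  if \dim V == 0%N then 0
  else if (\dim V <= \dim W)%N then
    Num.sqrt (\sum_(t <- principal_angles V W) t ^+ 2)
  else pi / 2 * Num.sqrt (\dim V)%:R.

Definition dg_segment (V W : Gr) : set Gr :=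
  [set U | dg V W = dg V U + dg U W]%classic.

Definition dg_between (V W : Gr) : set Gr :=
  (dg_segment V W `\` [set V; W])%classic.

End Grassmannian.

(* Main.v *)
From HB Require Import structures.
Require Import Defs.
From mathcomp Require Import all_boot all_order all_algebra.
From mathcomp Require Import sesquilinear spectral complex.
From mathcomp Require Import boolp classical_sets reals.
From mathcomp Require Import topology normedtype derive realfun trigo.
From mathcomp Require Import ring lra zify.

(* For [dim V <= dim W], convexity of [arccos ^ 2] and Jensen's inequality give
     dg V W ^ 2 = max (sum_j ang W (e j) ^ 2)
   over the orthonormal bases [e] of [V], where [ang W v] is the angle between
   the unit vector [v] and [W]; the maximum is attained at principal vectors.
   For the triangle inequality, take [e] attaining [dg V W], and let [u] be its
   image under the isometry of [V] onto some [U' <= U] that sends principal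
   vectors to principal vectors.  Jensen's inequality again bounds the angles of
   the pairs [(e j, u j)] by [dg V U], and it remains to add angles vector by
   vector and to apply Minkowski's inequality.

   If [dim V <= dim U <= dim W] and [U] lies between [V] and [W], equality in
   this argument forces [S], the orthogonal complement of [U'] in [U], into [W].
   Choosing [W'] of dimension [dim V] with [P_W U' <= W' <= W] and [W']
   orthogonal to [S], the chain
     dg V W <= dg V W' <= dg V U' + dg U' W' <= dg V U + dg U W
   consists of equalities; so [P_W V <= W'], and [T] is the orthogonal
   complement of [W'] in [W].  The other dimension patterns follow from
   [dg V W <= pi / 2 * sqrt (dim V)] and its equality case. *)

Set Implicit Arguments.
Unset Strict Implicit.
Unset Printing Implicit Defensive.

Import Order.TTheory GRing.Theory Num.Theory.
Import numFieldNormedType.Exports.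
Local Open Scope ring_scope.

(** * Angles and cosines *)

Section RealTrigo.
Variable R : realType.
Implicit Types (a b c t u v x y : R).

Lemma is_derive_ge0_le (f f' : R -> R) a b :
  (forall x, is_derive x 1 f (f' x)) ->
  (forall x, a < x < b -> 0 <= f' x) -> a <= b -> f a <= f b.
Proof.
move=> df f'_ge0 ab; apply: (ger0_derive1_le_cc (a := a) (b := b)) => //.
- by move=> x; rewrite in_itv /= => xab; rewrite derive1E derive_val; exact: f'_ge0.
- apply: continuous_subspaceT => x.
  exact/differentiable_continuous/derivable1_diffP.
- by rewrite in_itv /= lexx.
- by rewrite in_itv /= ab lexx.
Qed.

Lemma sin_le_id x : 0 <= x -> sin x <= x.
Proof.
move=> x0; rewrite -subr_ge0.
have := @is_derive_ge0_le (fun y => y - sin y) (fun y => 1 - cos y) 0 x.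
rewrite sin0 subrr; apply => // y _; by rewrite subr_ge0 cos_le1.
Qed.

(** The difference [sin y - y * cos y] vanishes at 0 and has derivative [y * sin y], nonnegative on
    [[0, pi]]. *)
Lemma mulr_cos_le_sin x : 0 <= x <= pi -> x * cos x <= sin x.
Proof.
move=> /andP[x0 xpi]; rewrite -subr_ge0.
have := @is_derive_ge0_le (fun y => sin y - y * cos y) (fun y => y * sin y) 0 x.
rewrite sin0 mul0r subrr; apply => // y.
  by apply: is_derive_eq; rewrite /GRing.scale /=; ring.
move=> /andP[y0 yx]; rewrite mulr_ge0 ?ltW// sin_gt0_pi// y0 /=.
exact: lt_le_trans xpi.
Qed.

(** With [b = a + c], the difference of the two sides is the sum of [a * sin a * (1 - cos c)],
    [sin a * (c - sin c)] and [sin c * (sin a - a * cos a)], all nonnegative. *)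
Lemma sinc_decreasing a b : 0 <= a -> a <= b -> b <= pi -> a * sin b <= b * sin a.
Proof.
move=> a0 ab bpi; have apia : 0 <= a <= pi by rewrite a0 (le_trans ab).
pose c := b - a; have c0 : 0 <= c by rewrite subr_ge0.
have bE : b = a + c by rewrite addrC subrK.
clearbody c; subst b.
have sa : 0 <= sin a := sin_ge0_pi apia.
have sc : 0 <= sin c by rewrite sin_ge0_pi// c0; lra.
have := mulr_cos_le_sin apia; have := sin_le_id c0; have := cos_le1 c.
rewrite sinD => h1 h2 h3.
have : 0 <= (a * sin a) * (1 - cos c) by rewrite !mulr_ge0// subr_ge0.
have : 0 <= sin c * (sin a - a * cos a) by rewrite mulr_ge0// subr_ge0.
have : 0 <= sin a * (c - sin c) by rewrite mulr_ge0// subr_ge0.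
by lra.
Qed.

(* The tangent line at [cos t] of the convex function [cos a |-> a ^ 2], whose
   derivative there is [- 2 t / sin t]; with [u = (a + t) / 2] and
   [v = (a - t) / 2] it becomes a comparison of values of [sin x / x]. *)
Lemma sqr_acos_tangent a t : 0 <= a <= pi -> 0 <= t <= pi ->
  0 <= sin t * (a ^+ 2 - t ^+ 2) + 2 * t * (cos a - cos t).
Proof.
move=> /andP[a0 api] /andP[t0 tpi].
pose u := (a + t) / 2; pose v := (a - t) / 2.
have aE : a = u + v by rewrite /u /v; field.
have tE : t = u - v by rewrite /u /v; field.
have u0 : 0 <= u by rewrite /u; lra.
have upi : u <= pi by rewrite /u; lra.
have vpi : v <= pi by rewrite /v; lra.
have vNpi : - pi <= v by rewrite /v; lra.
clearbody u v; subst a t.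
(* Since [a^2 - t^2 = 4 u v] and [cos a - cos t = - 2 sin u sin v], the expression to bound is four
   times the difference of these two sides. *)
suff : (u - v) * (sin u * sin v) <= sin (u - v) * (u * v).
  rewrite cosB cosD -subr_ge0 => le_uv.
  rewrite [leRHS](_ : _ = 4 * (sin (u - v) * (u * v) - (u - v) * (sin u * sin v))).
    by rewrite mulr_ge0.
  ring.
have [v0|v0] := leP 0 v.
  have h1 := @sinc_decreasing (u - v) u.
  have {}h1 : (u - v) * sin u <= u * sin (u - v) by apply: h1; lra.
  have h2 := sin_le_id v0.
  have su : 0 <= sin u by rewrite sin_ge0_pi// u0.
  have sv : 0 <= sin v by rewrite sin_ge0_pi// v0.
  have : 0 <= v * (u * sin (u - v) - (u - v) * sin u) by rewrite mulr_ge0// subr_ge0.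
  have : 0 <= (u - v) * sin u * (v - sin v).
    by rewrite !mulr_ge0 ?subr_ge0// -subr_ge0.
  lra.
(* For negative [v], expanding [sin (u + w)] splits the claim into [x cos x <= sin x] at [x = u] and
   at [x = w]. *)
pose w := - v.
have w0 : 0 <= w by rewrite /w; lra.
have vE : v = - w by rewrite /w opprK.
have wpi : w <= pi by rewrite /w; lra.
clearbody w; subst v.
rewrite opprK sinN sinD.
have hu : u * cos u <= sin u by rewrite mulr_cos_le_sin// u0.
have hw : w * cos w <= sin w by rewrite mulr_cos_le_sin// w0.
have su : 0 <= sin u by rewrite sin_ge0_pi// u0.
have sw : 0 <= sin w by rewrite sin_ge0_pi// w0.
have : 0 <= u * sin u * (sin w - w * cos w) by rewrite !mulr_ge0// subr_ge0.
have : 0 <= w * sin w * (sin u - u * cos u) by rewrite !mulr_ge0// subr_ge0.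
lra.
Qed.

Lemma ler_acos x y : -1 <= x -> x <= y -> y <= 1 -> acos y <= acos x.
Proof.
move=> x1 xy y1; have xI : -1 <= x <= 1 by rewrite x1 (le_trans xy).
have yI : -1 <= y <= 1 by rewrite y1 (le_trans x1).
rewrite leNgt; apply/negP => lt_acos.
have := @ltr_cos _ (acos x) (acos y).
rewrite !in_itv /= !acos_ge0 ?acos_lepi// => /(_ isT isT).
by rewrite lt_acos !acosK ?in_itv// ltNge xy.
Qed.

(** * Jensen's inequality for the squared arccosine *)

Section Jensen.
Variables (I : finType) (w x : I -> R).
Hypotheses (w_ge0 : forall i, 0 <= w i) (w_sum1 : \sum_i w i = 1).

Lemma convex_comb_itv a b : (forall i, a <= x i <= b) -> a <= \sum_i w i * x i <= b.
Proof.
move=> xab; rewrite -[a]mul1r -[b]mul1r -w_sum1 !mulr_suml; apply/andP; split;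
  by apply: ler_sum => i _; apply: ler_wpM2l => //; case/andP: (xab i).
Qed.

(** Average the tangent inequality at the barycenter [y]: the linear terms cancel because the
    cosines [x i] average to [y]. The factor [sin (acos y)] can be divided out only for [y] strictly
    between -1 and 1, so both endpoints are treated apart. *)
Lemma sqr_acos_jensen : (forall i, -1 <= x i <= 1) ->
  acos (\sum_i w i * x i) ^+ 2 <= \sum_i w i * acos (x i) ^+ 2.
Proof.
move=> x1; set y := \sum_i _.
have y1 : -1 <= y <= 1 by exact: convex_comb_itv.
have tpi : 0 <= acos y <= pi by rewrite acos_ge0 ?acos_lepi.
have cost : cos (acos y) = y by rewrite acosK ?in_itv.
(* A mean equal to the lower bound -1 forces [x i = -1] wherever the weight is nonzero. *)
have [yN1|yN1] := eqVneq y (-1).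
  have : \sum_i w i * (x i + 1) = 0.
    under eq_bigr do rewrite mulrDr mulr1.
    by rewrite big_split /= w_sum1 -/y yN1 addNr.
  move/eqP; rewrite psumr_eq0; last first.
    by move=> i _; rewrite mulr_ge0// -lerBlDr sub0r; case/andP: (x1 i).
  move=> /allP wx0; rewrite yN1 acosN1 -[leLHS]mul1r -w_sum1 mulr_suml.
  apply: ler_sum => i _; have := wx0 i (mem_index_enum _).
  rewrite mulf_eq0 => /orP[/eqP->|]; first by rewrite !mul0r.
  by rewrite addr_eq0 => /eqP->; rewrite acosN1.
have [->|yne1] := eqVneq y 1.
  by rewrite acos1 expr0n /= sumr_ge0// => i _; rewrite mulr_ge0// sqr_ge0.
have s0 : 0 < sin (acos y).
  case/andP: y1 => y1 y1'; rewrite sin_gt0_pi// acos_gt0 ?acos_ltpi//.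
    by rewrite y1' andbT lt_def yN1.
  by rewrite y1 lt_def eq_sym yne1.
rewrite -subr_ge0 -(pmulr_rge0 _ s0).
have yE : \sum_i w i * x i = y by [].
clearbody y.
have -> : sin (acos y) * (\sum_i w i * acos (x i) ^+ 2 - acos y ^+ 2) =
  \sum_i w i * (sin (acos y) * (acos (x i) ^+ 2 - acos y ^+ 2)
                 + 2 * acos y * (cos (acos (x i)) - cos (acos y))).
  transitivity (sin (acos y) * (\sum_i w i * acos (x i) ^+ 2)
    + 2 * acos y * (\sum_i w i * x i)
    - (\sum_i w i) * (sin (acos y) * acos y ^+ 2 + 2 * acos y * y)).
    by rewrite w_sum1 yE; ring.
  rewrite mulr_suml !mulr_sumr -big_split -sumrB /=; apply: eq_bigr => i _.
  rewrite cost acosK ?in_itv ?x1//; ring.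
apply: sumr_ge0 => i _; rewrite mulr_ge0//; apply: sqr_acos_tangent => //.
by rewrite acos_ge0 ?acos_lepi.
Qed.

End Jensen.

(** The double-angle formula: if [x = cos t ^ 2], then [2 x - 1 = cos (2 t)]. As [2 x - 1] is affine
    in [x], Jensen's inequality carries over to [acos (sqrt x) ^ 2]. *)
Lemma acos_sqrt x : 0 <= x <= 1 -> acos (Num.sqrt x) = acos (2 * x - 1) / 2.
Proof.
move=> /andP[x0 x1].
have s0 : 0 <= Num.sqrt x := sqrtr_ge0 x.
have s1 : Num.sqrt x <= 1 by rewrite -sqrtr1 ler_wsqrtr.
have sI : -1 <= Num.sqrt x <= 1 by lra.
set t := acos _; have ct : cos t = Num.sqrt x by rewrite acosK ?in_itv.
have t0 : 0 <= t := acos_ge0 sI.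
have tpi : t <= pi / 2 by rewrite -acos0 ler_acos//; lra.
have -> : 2 * x - 1 = cos (t + t).
  by rewrite -mulr2n cos_mulr2n ct sqr_sqrtr// mulr_natl.
by rewrite cosK ?in_itv /=; lra.
Qed.

Lemma sqr_acos_sqrt_jensen (I : finType) (w x : I -> R) :
  (forall i, 0 <= w i) -> \sum_i w i = 1 -> (forall i, 0 <= x i <= 1) ->
  acos (Num.sqrt (\sum_i w i * x i)) ^+ 2 <=
    \sum_i w i * acos (Num.sqrt (x i)) ^+ 2.
Proof.
move=> w0 w1 x01.
rewrite acos_sqrt; last exact: convex_comb_itv.
rewrite [leRHS](eq_bigr (fun i => w i * (acos (2 * x i - 1) / 2) ^+ 2)); last first.
  by move=> i _; rewrite acos_sqrt.
have -> : 2 * (\sum_i w i * x i) - 1 = \sum_i w i * (2 * x i - 1).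
  rewrite mulr_sumr -[X in _ - X]w1 -sumrB; apply: eq_bigr => i _; ring.
rewrite expr_div_n; under eq_bigr do rewrite expr_div_n mulrA.
rewrite -mulr_suml ler_pM2r ?invr_gt0 ?exprn_gt0//.
by apply: sqr_acos_jensen => // i; have := x01 i; lra.
Qed.

(** * Quadratic forms and Minkowski's inequality *)

Lemma discriminant_le (a b c : R) : 0 <= c ->
  (forall t, 0 <= a + 2 * t * b + t ^+ 2 * c) -> b ^+ 2 <= a * c.
Proof.
rewrite le_eqVlt => /predU1P[<- pos|c0 pos].
  have [->|b0] := eqVneq b 0; first by rewrite expr0n mulr0.
  (* With [c = 0] the polynomial is affine in [t]; this [t] is chosen so that its value is -1. *)
  have := pos (- (a + 1) / (2 * b)).
  rewrite mulr0 addr0 [X in a + X](_ : _ = - (a + 1)); last by field.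
  by lra.
have := pos (- b / c).
rewrite -(pmulr_lge0 _ c0) [X in 0 <= X](_ : _ = a * c - b ^+ 2); last first.
  by field; rewrite gt_eqF.
by rewrite subr_ge0.
Qed.

(** Minkowski's inequality. The discriminant of [\sum_i (x i + t * y i) ^+ 2] in [t] gives
    Cauchy-Schwarz, which bounds the cross term. *)
Lemma l2_triangle (I : finType) (x y : I -> R) :
  Num.sqrt (\sum_i (x i + y i) ^+ 2) <=
    Num.sqrt (\sum_i x i ^+ 2) + Num.sqrt (\sum_i y i ^+ 2).
Proof.
set A := \sum_i x i ^+ 2; set C := \sum_i y i ^+ 2; pose B := \sum_i x i * y i.
have A0 : 0 <= A by apply: sumr_ge0 => i _; exact: sqr_ge0.
have C0 : 0 <= C by apply: sumr_ge0 => i _; exact: sqr_ge0.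
have quad t : \sum_i (x i + t * y i) ^+ 2 = A + 2 * t * B + t ^+ 2 * C.
  rewrite !mulr_sumr -!big_split; apply: eq_bigr => i _ /=; ring.
have : B ^+ 2 <= A * C.
  by apply: discriminant_le => // t; rewrite -quad sumr_ge0// => i _; exact: sqr_ge0.
move=> BAC; have {}BAC : B <= Num.sqrt A * Num.sqrt C.
  by rewrite -sqrtrM// (le_trans (ler_norm B))// -sqrtr_sqr ler_wsqrtr.
have -> : \sum_i (x i + y i) ^+ 2 = A + 2 * B + C.
  have := quad 1; rewrite expr1n mulr1 mul1r => <-.
  by apply: eq_bigr => i _; rewrite mul1r.
rewrite -[leRHS]ger0_norm ?addr_ge0 ?sqrtr_ge0// -sqrtr_sqr ler_wsqrtr//.
rewrite sqrrD !sqr_sqrtr//; move: BAC; lra.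
Qed.

End RealTrigo.

(** * Scalars *)

Section Scalars.
Variables (R : realType) (k : scalar_kind).
Local Notation F := (scalar_field R k).
Local Notation conj := (scalar_conj R k).
Local Notation ofR := (@scalar_of_real R k).

Definition scalar_re : F -> R :=
  match k return scalar_field R k -> R with
  | RealScalars => idfun
  | ComplexScalars => @complex.Re R
  end.

Fact scalar_re_is_zmod_morphism : zmod_morphism scalar_re.
Proof. by rewrite /scalar_re; case: k => // -[a b] [c d]. Qed.

HB.instance Definition _ :=
  GRing.isZmodMorphism.Build F R scalar_re scalar_re_is_zmod_morphism.

Fact scalar_of_real_is_zmod_morphism : zmod_morphism ofR.
Proof. by rewrite /scalar_of_real; case: k => // a b; exact: rmorphB. Qed.

HB.instance Definition _ :=
  GRing.isZmodMorphism.Build R F ofR scalar_of_real_is_zmod_morphism.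

Fact scalar_of_real_is_monoid_morphism : monoid_morphism ofR.
Proof.
rewrite /scalar_of_real; case: k => //.
by split; [exact: rmorph1 | exact: rmorphM].
Qed.

HB.instance Definition _ :=
  GRing.isMonoidMorphism.Build R F ofR scalar_of_real_is_monoid_morphism.

Lemma scalar_of_realK : cancel ofR scalar_re.
Proof. by rewrite /scalar_re /scalar_of_real; case: k. Qed.

Lemma scalar_reZ a z : scalar_re (ofR a * z) = a * scalar_re z.
Proof.
move: z; rewrite /scalar_re /scalar_of_real; case: k => // -[b c] /=.
by rewrite mul0r subr0.
Qed.

Lemma scalar_conj_real a : conj (ofR a) = ofR a.
Proof.
rewrite /scalar_conj /scalar_of_real; case: k => //=.
by congr (_ +i* _)%C; rewrite oppr0.
Qed.

Lemma scalar_re_conj z : scalar_re (conj z) = scalar_re z.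
Proof. by move: z; rewrite /scalar_re /scalar_conj; case: k => // -[]. Qed.

(** The squared modulus, taken in [R] for both kinds of scalars so that it can be ordered and used
    as a Jensen weight. *)
Definition scalar_sqn z : R := scalar_re (z * conj z).

Lemma scalar_mul_conj z : z * conj z = ofR (scalar_sqn z).
Proof.
move: z; rewrite /scalar_sqn /scalar_re /scalar_conj /scalar_of_real.
case: k => //= -[a b]; congr (_ +i* _)%C; ring.
Qed.

Lemma scalar_sqn_ge0 z : 0 <= scalar_sqn z.
Proof.
move: z; rewrite /scalar_sqn /scalar_re /scalar_conj.
case: k => [z|[a b]] /=; first by rewrite -expr2 sqr_ge0.
by rewrite mulrN opprK addr_ge0// -expr2 sqr_ge0.
Qed.

Lemma scalar_sqn_eq0 z : (scalar_sqn z == 0) = (z == 0).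
Proof.
apply/eqP/eqP => [z0|->]; last by rewrite /scalar_sqn mul0r raddf0.
have := scalar_mul_conj z; rewrite z0 rmorph0 => /eqP.
by rewrite mulf_eq0 fmorph_eq0 orbb => /eqP.
Qed.

Lemma scalar_sqn_conj z : scalar_sqn (conj z) = scalar_sqn z.
Proof. by rewrite /scalar_sqn rmorphK mulrC. Qed.

End Scalars.

(** * Inner product and orthogonal projections *)

Section InnerProduct.
Variables (R : realType) (k : scalar_kind) (n : nat).
Local Notation F := (scalar_field R k).
Local Notation conj := (scalar_conj R k).
Local Notation ofR := (@scalar_of_real R k).
Local Notation re := (@scalar_re R k).
Local Notation sqn := (@scalar_sqn R k).
Local Notation inner := (@inner R k n).
Implicit Types (u v w x y : 'rV[F]_n) (U V W X : {vspace 'rV[F]_n}).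

Lemma innerC u v : inner u v = conj (inner v u).
Proof. by rewrite inner_is_hermitian expr0 mul1r. Qed.

Lemma innerDl u v w : inner (u + v) w = inner u w + inner v w.
Proof. exact: linearDl. Qed.

Lemma innerDr u v w : inner u (v + w) = inner u v + inner u w.
Proof. exact: linearDr. Qed.

Lemma innerBl u v w : inner (u - v) w = inner u w - inner v w.
Proof. exact: linearBl. Qed.

Lemma innerBr u v w : inner u (v - w) = inner u v - inner u w.
Proof. exact: linearBr. Qed.

Lemma inner0l u : inner 0 u = 0.
Proof. exact: linear0l. Qed.

Lemma innerZl a u v : inner (a *: u) v = a * inner u v.
Proof. exact: linearZl_LR. Qed.

Lemma innerZr a u v : inner u (a *: v) = conj a * inner u v.
Proof. exact: linearZr_LR. Qed.

Lemma inner_suml I (r : seq I) (P : pred I) (f : I -> 'rV[F]_n) v :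
  inner (\sum_(i <- r | P i) f i) v = \sum_(i <- r | P i) inner (f i) v.
Proof. exact: linear_sumlz. Qed.

Lemma inner_sumr I (r : seq I) (P : pred I) u (f : I -> 'rV[F]_n) :
  inner u (\sum_(i <- r | P i) f i) = \sum_(i <- r | P i) inner u (f i).
Proof. exact: linear_sumr. Qed.

Lemma inner_eq0C u v : inner u v = 0 -> inner v u = 0.
Proof. by move=> uv; rewrite innerC uv rmorph0. Qed.

Definition nsq u : R := re (inner u u).

Lemma inner_self u : inner u u = ofR (nsq u).
Proof.
rewrite /nsq /Defs.inner raddf_sum rmorph_sum; apply: eq_bigr => i _.
exact: scalar_mul_conj.
Qed.

Lemma nsq_ge0 u : 0 <= nsq u.
Proof.
rewrite /nsq /Defs.inner raddf_sum; apply: sumr_ge0 => i _.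
exact: scalar_sqn_ge0.
Qed.

Lemma nsq_eq0 u : nsq u = 0 -> u = 0.
Proof.
rewrite /nsq /Defs.inner raddf_sum => /eqP; rewrite psumr_eq0; last first.
  by move=> i _; exact: scalar_sqn_ge0.
move=> /allP h; apply/rowP => i; rewrite mxE; apply/eqP.
by rewrite -scalar_sqn_eq0; exact: h (mem_index_enum _).
Qed.

Lemma inner_eq0 u : inner u u = 0 -> u = 0.
Proof. by move=> uu; apply: nsq_eq0; rewrite /nsq uu raddf0. Qed.

Lemma nsqZ a u : nsq (a *: u) = sqn a * nsq u.
Proof.
rewrite {1}/nsq innerZl innerZr mulrA scalar_mul_conj.
by rewrite scalar_reZ.
Qed.

Lemma scalar_sqn_real a : sqn (ofR a) = a ^+ 2.
Proof. by rewrite /scalar_sqn scalar_conj_real scalar_reZ scalar_of_realK expr2. Qed.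

Lemma nsqD u v : nsq (u + v) = nsq u + 2 * re (inner u v) + nsq v.
Proof.
rewrite {1}/nsq innerDl !innerDr !raddfD /= -/(nsq u) -/(nsq v).
rewrite [inner v u]innerC scalar_re_conj; ring.
Qed.

Lemma nsqD_orth u v : inner u v = 0 -> nsq (u + v) = nsq u + nsq v.
Proof. by move=> uv; rewrite nsqD uv raddf0 mulr0 addr0. Qed.

(** The discriminant of [nsq (u + t v)] as a quadratic polynomial in the real variable [t], whose
    middle coefficient is a real part. *)
Lemma inner_cauchy_schwarz u v : re (inner u v) ^+ 2 <= nsq u * nsq v.
Proof.
apply: discriminant_le => [|t]; first exact: nsq_ge0.
have := nsq_ge0 (u + ofR t *: v).
by rewrite nsqD nsqZ innerZr scalar_conj_real scalar_reZ scalar_sqn_real mulrA.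
Qed.

Lemma mem_orthocomplP V u :
  reflect {in V, forall v, inner u v = 0} (u \in orthocompl V).
Proof. exact: mem_orthovP. Qed.

Lemma orthosubP U V :
  reflect {in U & V, forall u v, inner u v = 0} (orthosub U V).
Proof. exact: orthovP. Qed.

(** * Orthonormal families and orthonormal bases *)

(** Indexing by ['I_m] instead of using a sequence lets expansions and convex combinations range
    over a finite type. *)
Definition orthofam m (e : 'I_m -> 'rV[F]_n) :=
  forall i j, inner (e i) (e j) = (i == j)%:R.

Lemma orthofam_nsq m (e : 'I_m -> 'rV[F]_n) i : orthofam e -> nsq (e i) = 1.
Proof.
by move=> oe; rewrite /nsq oe eqxx -(rmorph1 (scalar_of_real k)) scalar_of_realK.
Qed.

Lemma inner_orthofam_sum m (e : 'I_m -> 'rV[F]_n) (c : 'I_m -> F) i :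
  orthofam e -> inner (\sum_j c j *: e j) (e i) = c i.
Proof.
move=> oe; rewrite inner_suml (bigD1 i) //= big1 => [|j ji].
  by rewrite innerZl oe eqxx mulr1 addr0.
by rewrite innerZl oe (negPf ji) mulr0.
Qed.

Definition famspan m (e : 'I_m -> 'rV[F]_n) : {vspace 'rV[F]_n} :=
  <<[seq e i | i <- enum 'I_m]>>%VS.

Section OrthonormalFamily.
Variables (m : nat) (e : 'I_m -> 'rV[F]_n).

Lemma mem_famspan i : e i \in famspan e.
Proof. by apply/memv_span/mapP; exists i; rewrite ?mem_enum. Qed.

Lemma famspan_subP V : reflect (forall i, e i \in V) (famspan e <= V)%VS.
Proof.
apply: (iffP span_subvP) => [eV i|eV _ /mapP[i _ ->]//].
by apply/eV/mapP; exists i; rewrite ?mem_enum.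
Qed.

Let e_tuple : m.-tuple 'rV[F]_n := [tuple of [seq e i | i <- ord_tuple m]].

Let e_tupleE : e_tuple = [seq e i | i <- enum 'I_m] :> seq _.
Proof. by []. Qed.

Let e_tuple_nth (i : 'I_m) : e_tuple`_i = e i.
Proof. by rewrite (nth_map i) ?size_enum_ord// nth_ord_enum. Qed.

Lemma famspan_sum v : v \in famspan e -> exists c : 'I_m -> F, v = \sum_i c i *: e i.
Proof.
rewrite /famspan -e_tupleE => /coord_span ->.
by exists (fun i => coord e_tuple i v); apply: eq_bigr => i _; rewrite e_tuple_nth.
Qed.

Hypothesis oe : orthofam e.

Lemma orthofam_free : free [seq e i | i <- enum 'I_m].
Proof.
rewrite -e_tupleE; apply/freeP => c c0 i.
rewrite -(inner_orthofam_sum c i oe).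
under eq_bigr do rewrite -e_tuple_nth.
by rewrite c0 inner0l.
Qed.

Lemma dim_famspan : \dim (famspan e) = m.
Proof. by have /eqP-> := orthofam_free; rewrite size_map size_enum_ord. Qed.

Lemma famspan_eq V : (forall i, e i \in V) -> \dim V = m -> famspan e = V.
Proof.
move=> eV dV; apply/eqP; rewrite eqEdim dim_famspan dV leqnn andbT.
exact/famspan_subP.
Qed.

Lemma orthofam_expand v : v \in famspan e -> v = \sum_i inner v (e i) *: e i.
Proof.
move=> /famspan_sum[c vE]; rewrite {1}vE; apply: eq_bigr => i _.
by rewrite vE inner_orthofam_sum.
Qed.

Lemma inner_expand u v : u \in famspan e ->
  inner u v = \sum_i inner u (e i) * conj (inner v (e i)).
Proof.
move=> /orthofam_expand {1}->; rewrite inner_suml; apply: eq_bigr => i _.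
by rewrite innerZl [inner (e i) v]innerC.
Qed.

Lemma nsq_expand v : v \in famspan e -> nsq v = \sum_i sqn (inner v (e i)).
Proof. by move=> ve; rewrite /nsq (inner_expand _ ve) raddf_sum. Qed.

Lemma famspan_residual v :
  v - \sum_i inner v (e i) *: e i \in orthocompl (famspan e).
Proof.
apply/mem_orthocomplP => w /famspan_sum[c ->]; rewrite inner_sumr big1// => i _.
by rewrite innerZr innerBl inner_orthofam_sum// subrr mulr0.
Qed.

End OrthonormalFamily.

Lemma exists_unit V : V != 0%VS -> exists2 v, v \in V & inner v v = 1.
Proof.
move=> V0; pose v := vpick V; pose c := (Num.sqrt (nsq v))^-1.
have v0 : nsq v != 0.
  by apply: contra_neq V0 => /nsq_eq0/eqP; rewrite vpick0 => /eqP.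
exists (ofR c *: v); first by rewrite memvZ// memv_pick.
rewrite inner_self nsqZ scalar_sqn_real /c exprVn sqr_sqrtr ?nsq_ge0//.
by rewrite mulVf// rmorph1.
Qed.

(* A basis built one unit vector at a time, each chosen in the orthogonal
   complement of its predecessors. *)
Lemma orthobasis_ind (K : 'rV[F]_n -> 'rV[F]_n -> Prop) V :
  (forall X, (X <= V)%VS -> X != 0%VS -> exists x, [/\ x \in X, inner x x = 1 &
     {in X, forall y, inner y x = 0 -> K x y}]) ->
  exists e : seq 'rV[F]_n, [/\ size e = \dim V, {subset e <= V},
    {in e, forall x, inner x x = 1} &
    pairwise (fun x y => (inner y x == 0) && `[<K x y>]) e].
Proof.
have [m] := ubnP (\dim V); elim: m V => // m IH V; rewrite ltnS => dV step.
have [->|V0] := eqVneq V 0%VS; first by exists [::]; rewrite dimv0.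
have [x [xV x1 Kx]] := step V (subvv V) V0.
(* A unit vector is not orthogonal to itself, so its orthogonal complement cuts [V] in codimension
   one. *)
have dW : \dim (V :&: orthocompl <[x]>) = (\dim V).-1.
  rewrite -eq_dim_orthov1//; apply/mem_orthovPn; exists x => //.
  by apply/negP => /eqP xx0; move: (oner_neq0 F); rewrite -x1 [inner x x]xx0 eqxx.
have V_gt0 : (0 < \dim V)%N by rewrite lt0n dimv_eq0.
have [|X XW X0|e [se eW e1 eK]] := IH (V :&: orthocompl <[x]>)%VS.
- by rewrite dW; case: (\dim V) V_gt0 dV.
- by apply: step X0; rewrite (subv_trans XW)// capvSl.
exists (x :: e); split.
- by rewrite /= se dW prednK.
- by move=> y; rewrite inE => /predU1P[->//|/eW]; rewrite memv_cap => /andP[].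
- by move=> y; rewrite inE => /predU1P[->//|/e1].
rewrite /= eK andbT; apply/allP => y /eW; rewrite memv_cap => /andP[yV /mem_orthocomplP yx].
have {}yx : inner y x = 0 by rewrite yx// memv_line.
by rewrite yx eqxx/=; apply/asboolP/Kx.
Qed.

Lemma exists_orthobasis V m : \dim V = m -> 
  exists2 e : 'I_m -> 'rV[F]_n, orthofam e & famspan e = V.
Proof.
move=> dV; have [|e [se eV e1 /pairwiseP eK]] := @orthobasis_ind (fun _ _ => True) V.
  by move=> X _ /exists_unit[x xX x1]; exists x.
have oe : orthofam (fun i : 'I_m => e`_i).
  have small (i : 'I_m) : (i < size e)%N by rewrite se dV.
  move=> i j; case: (ltngtP i j) => ij.
  - have /andP[/eqP/inner_eq0C-> _] := eK 0 i j (small i) (small j) ij.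
    by rewrite (_ : (i == j) = false)//; apply/negbTE; rewrite neq_ltn ij.
  - have /andP[/eqP-> _] := eK 0 j i (small j) (small i) ij.
    by rewrite (_ : (i == j) = false)//; apply/negbTE; rewrite neq_ltn ij orbT.
  - by rewrite (val_inj ij) eqxx e1// mem_nth.
exists (fun i => e`_i) => //; apply: famspan_eq => // i.
by apply/eV/mem_nth; rewrite se dV.
Qed.

(** * Orthogonal complements and projections *)

Lemma orthocompl_direct V : (V :&: orthocompl V = 0)%VS.
Proof.
apply/eqP; rewrite -subv0; apply/subvP => v; rewrite memv_cap memv0.
by move=> /andP[vV /mem_orthocomplP vV']; apply/eqP/inner_eq0/vV'.
Qed.

(** A vector minus its expansion in an orthonormal basis of [V] is orthogonal to [V]. *)
Lemma addv_orthocompl V : (V + orthocompl V = fullv)%VS.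
Proof.
apply/eqP; rewrite eqEsubv subvf; apply/subvP => v _.
have [e oe eV] := exists_orthobasis (erefl (\dim V)).
rewrite -[v](subrK (\sum_i inner v (e i) *: e i)) addrC memv_add//.
  by apply: memv_suml => i _; rewrite memvZ// -eV mem_famspan.
by rewrite -[X in orthocompl X]eV famspan_residual.
Qed.

Local Notation P := (@orthoproj R k n).

Lemma mem_orthoproj W v : P W v \in W.
Proof. exact: memv_pi. Qed.

Lemma orthoproj_residual W v : v - P W v \in orthocompl W.
Proof.
have := @daddv_pi_add _ _ W (orthocompl W) v (orthocompl_direct W).
rewrite addv_orthocompl => /(_ (memvf v)) => vE.
by rewrite -{1}vE /orthoproj [X in X - _]addrC addrK memv_pi.
Qed.

Lemma orthoproj_unique W v w : w \in W -> v - w \in orthocompl W -> P W v = w.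
Proof.
move=> wW vw; apply/eqP; rewrite -subr_eq0 -memv0 -(orthocompl_direct W) memv_cap.
rewrite memvB ?mem_orthoproj//=.
have -> : P W v - w = (v - w) - (v - P W v) by rewrite opprB [RHS]addrC addrA subrK.
by rewrite memvB// orthoproj_residual.
Qed.

Lemma inner_orthoprojl W v w : w \in W -> inner (P W v) w = inner v w.
Proof.
move=> wW; apply/esym/eqP; rewrite -subr_eq0 -innerBl; apply/eqP.
by move/mem_orthocomplP: (orthoproj_residual W v); apply.
Qed.

Lemma orthoproj_id W v : v \in W -> P W v = v.
Proof. by move=> vW; apply: orthoproj_unique; rewrite // subrr mem0v. Qed.

Lemma nsq_orthoproj W v : nsq v = nsq (P W v) + nsq (v - P W v).
Proof.
have -> : nsq v = nsq (P W v + (v - P W v)) by rewrite addrC subrK.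
apply/nsqD_orth/inner_eq0C.
by move/mem_orthocomplP: (orthoproj_residual W v); apply; exact: mem_orthoproj.
Qed.

Lemma nsq_orthoproj_le W v : nsq (P W v) <= nsq v.
Proof. by rewrite [leRHS](nsq_orthoproj W) lerDl nsq_ge0. Qed.

Lemma nsq_orthoproj_eq W v : nsq (P W v) = nsq v -> v \in W.
Proof.
rewrite [in RHS](nsq_orthoproj W) => /eqP; rewrite -subr_eq0 opprD addNKr oppr_eq0.
by move=> /eqP/nsq_eq0/eqP; rewrite subr_eq0 => /eqP->; exact: mem_orthoproj.
Qed.

Lemma orthoproj_subK X W v : (X <= W)%VS -> P X (P W v) = P X v.
Proof.
move=> XW; apply/esym/orthoproj_unique; first exact: mem_orthoproj.
apply/mem_orthocomplP => x xX.
by rewrite innerBl !inner_orthoprojl ?subrr// (subvP XW).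
Qed.

End InnerProduct.

(** * Diagonalization *)

Lemma exists_sorting_perm (R : realType) m (f : 'I_m -> R) :
  exists2 s : 'I_m -> 'I_m, injective s & forall i j : 'I_m, (i <= j)%N -> f (s j) <= f (s i).
Proof.
pose r := [rel i j : 'I_m | f j <= f i]; pose t := sort r (enum 'I_m).
have szt : size t = m by rewrite size_sort size_enum_ord.
have rtot : total r by move=> i j; exact: le_total.
have rtr : transitive r by move=> j i l /= fji flj; exact: le_trans fji.
exists (fun i => nth i t i) => [i j|i j ij].
  rewrite (set_nth_default j) ?szt// => /eqP.
  by rewrite nth_uniq ?szt ?sort_uniq ?enum_uniq// => /eqP/val_inj.
rewrite (set_nth_default j) ?szt//.
have := sorted_leq_nth rtr (fun i => lexx (f i)) j (sort_sorted rtot (enum 'I_m)).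
by apply; rewrite ?inE ?szt.
Qed.

(** Over the complex numbers [M] has an eigenvalue by algebraic closedness. Symmetry makes [M]
    self-adjoint for the Hermitian product, so the eigenvalue is real; it is then an eigenvalue of
    the real matrix too. *)
Lemma real_symmetric_eigenvector (R : realType) m (M : 'M[R]_m) :
  (0 < m)%N -> (forall i j, M i j = M j i) ->
  exists a (v : 'rV[R]_m), v != 0 /\ v *m M = a *: v.
Proof.
move=> m0 symM; pose Mc := map_mx (real_complex R) M.
have [a eva] := eigenvalue_closed Mc m0.
have [v vM v0] := eigenvalueP eva.
pose dot := @inner R ComplexScalars m.
have self_adj : dot (v *m Mc) v = dot v (v *m Mc).
  rewrite /dot /inner /=.
  under eq_bigr do rewrite mxE mulr_suml.
  under [RHS]eq_bigr do rewrite mxE rmorph_sum mulr_sumr.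
  rewrite exchange_big; apply: eq_bigr => j _; apply: eq_bigr => i _.
  by rewrite rmorphM !mxE symM /= (scalar_conj_real ComplexScalars) mulrAC mulrA.
have dv0 : dot v v != 0 by apply: contra_neq v0; exact: inner_eq0.
have : a * dot v v = (scalar_conj R ComplexScalars) a * dot v v.
  have <- : dot (a *: v) v = a * dot v v by exact: (@innerZl R ComplexScalars).
  by rewrite -vM self_adj vM; exact: (@innerZr R ComplexScalars).
move/(mulIf dv0); case: a eva {vM} => x y eva /= [yE].
have {}yE : y = 0 by lra.
have /eigenvalueP[w wM w0] : eigenvalue M x.
  by rewrite -(eigenvalue_map (real_complex R)) /=; rewrite yE in eva.
by exists x, w.
Qed.

Lemma hermitian_eigenvector (R : realType) (k : scalar_kind) m
    (M : 'M[scalar_field R k]_m) :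
  (0 < m)%N -> (forall i j, M i j = scalar_conj R k (M j i)) ->
  exists a (v : 'rV[scalar_field R k]_m), v != 0 /\ v *m M = a *: v.
Proof.
case: k M => M m0 symM; first exact: real_symmetric_eigenvector.
have [a /eigenvalueP[v vM v0]] := eigenvalue_closed (M : 'M[R[i]]_m) m0.
by exists a, v.
Qed.

(** * Concatenation and completion of orthonormal families *)

Section FamilyCat.
Variables (R : realType) (k : scalar_kind) (n : nat).
Local Notation F := (scalar_field R k).
Implicit Types (V W : {vspace 'rV[F]_n}).

Definition famcat a b (e : 'I_a -> 'rV[F]_n) (f : 'I_b -> 'rV[F]_n) (i : 'I_(a + b)) :=
  match split i with inl j => e j | inr j => f j end.

Lemma famcat_lshift a b (e : 'I_a -> 'rV[F]_n) (f : 'I_b -> 'rV[F]_n) i :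
  famcat e f (lshift b i) = e i.
Proof. by rewrite /famcat -[lshift b i]/(unsplit (inl i)) unsplitK. Qed.

Lemma famcat_rshift a b (e : 'I_a -> 'rV[F]_n) (f : 'I_b -> 'rV[F]_n) i :
  famcat e f (rshift a i) = f i.
Proof. by rewrite /famcat -[rshift a i]/(unsplit (inr i)) unsplitK. Qed.

Lemma orthofam_cat a b (e : 'I_a -> 'rV[F]_n) (f : 'I_b -> 'rV[F]_n) :
  orthofam e -> orthofam f -> (forall i j, inner (e i) (f j) = 0) ->
  orthofam (famcat e f).
Proof.
move=> oe of_ ef i j; case: (splitP i) => i' ii; case: (splitP j) => j' jj.
- have -> : i = lshift b i' by exact: val_inj.
  have -> : j = lshift b j' by exact: val_inj.
  by rewrite !famcat_lshift oe eq_lshift.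
- have -> : i = lshift b i' by exact: val_inj.
  have -> : j = rshift a j' by exact: val_inj.
  by rewrite famcat_lshift famcat_rshift ef eq_lrshift.
- have -> : i = rshift a i' by exact: val_inj.
  have -> : j = lshift b j' by exact: val_inj.
  by rewrite famcat_lshift famcat_rshift eq_rlshift; apply: inner_eq0C.
- have -> : i = rshift a i' by exact: val_inj.
  have -> : j = rshift a j' by exact: val_inj.
  by rewrite !famcat_rshift of_ eq_rshift.
Qed.

Lemma famcat_mem a b (e : 'I_a -> 'rV[F]_n) (f : 'I_b -> 'rV[F]_n) W :
  (forall i, e i \in W) -> (forall i, f i \in W) -> forall i, famcat e f i \in W.
Proof. by move=> eW fW i; rewrite /famcat; case: split. Qed.

Lemma orthocompl_decomp X W : (X <= W)%VS -> (X + (W :&: orthocompl X) = W)%VS.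
Proof.
move=> XW; apply/eqP; rewrite eqEsubv subv_add XW capvSl /=; apply/subvP => w wW.
have -> : w = orthoproj X w + (w - orthoproj X w) by rewrite addrC subrK.
have PX := mem_orthoproj X w.
rewrite memv_add// memv_cap orthoproj_residual andbT memvB//.
exact: subvP PX.
Qed.

Lemma dim_orthocompl_in X W : (X <= W)%VS ->
  (\dim X + \dim (W :&: orthocompl X))%N = \dim W.
Proof.
move=> XW; rewrite -[in RHS](orthocompl_decomp XW) dimv_disjoint_sum//.
by rewrite capvC -capvA [X in (_ :&: X)%VS]capvC orthocompl_direct capv0.
Qed.

Lemma orthofam_extend a q (e : 'I_a -> 'rV[F]_n) W :
  orthofam e -> (forall i, e i \in W) -> \dim W = q ->
  exists b (f : 'I_b -> 'rV[F]_n), (a + b)%N = q /\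
    [/\ orthofam f, famspan f = (W :&: orthocompl (famspan e))%VS,
        forall i j, inner (e i) (f j) = 0 & orthofam (famcat e f)].
Proof.
move=> oe eW dW.
have [f of_ fE] := exists_orthobasis (erefl (\dim (W :&: orthocompl (famspan e)))).
exists (\dim (W :&: orthocompl (famspan e))), f.
have ef i j : inner (e i) (f j) = 0.
  apply: inner_eq0C; have : f j \in (W :&: orthocompl (famspan e))%VS.
    by rewrite -fE mem_famspan.
  by rewrite memv_cap => /andP[_ /mem_orthocomplP]; apply; exact: mem_famspan.
split; last by split => //; exact: orthofam_cat.
by rewrite -{1}(dim_famspan oe) dim_orthocompl_in//; apply/famspan_subP.
Qed.

End FamilyCat.

(** * Diagonalizing the compression of a projection *)

Section PrincipalVectors.
Variables (R : realType) (k : scalar_kind) (n : nat).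
Local Notation F := (scalar_field R k).
Local Notation conj := (scalar_conj R k).
Local Notation P := (@orthoproj R k n).
Implicit Types (U V W X : {vspace 'rV[F]_n}).

(** The Gram matrix [M] of the projections of an orthonormal basis represents the form
    [inner (P W x) (P W z)] on [X]. If the coordinates of [x] form an eigenvector of [M] for [a],
    this form equals [a * inner x z]; a unit vector on the line of [x] then works. *)
Lemma exists_compression_eigenvector W X : X != 0%VS ->
  exists x, [/\ x \in X, inner x x = 1 &
    {in X, forall y, inner y x = 0 -> inner (P W x) (P W y) = 0}].
Proof.
move=> X0; have [e oe eX] := exists_orthobasis (erefl (\dim X)).
have eXi i : e i \in X by have := mem_famspan e i; rewrite eX.
pose M : 'M[F]_(\dim X) := \matrix_(i, j) inner (P W (e i)) (P W (e j)).
have [||a [v [v0 vM]]] := @hermitian_eigenvector R k _ M.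
- by rewrite lt0n dimv_eq0.
- by move=> i j; rewrite !mxE innerC.
pose x := \sum_i v 0 i *: e i.
have x0 : (<[x]> != 0)%VS.
  rewrite -dimv_eq0 dim_vline eqb0 negbK; apply: contra_neq v0 => x0.
  by apply/rowP => i; rewrite mxE -(inner_orthofam_sum (v 0) i oe) -/x x0 inner0l.
have [y /vlineP[c yE] y1] := exists_unit x0.
exists y; split => //.
  by rewrite yE memvZ// memv_suml// => i _; rewrite memvZ.
move=> z zX zy; rewrite yE linearZ innerZl.
have zE : z = \sum_j inner z (e j) *: e j by apply: orthofam_expand; rewrite ?[famspan e]eX.
have -> : inner (P W x) (P W z) = a * inner x z.
  have -> : inner (P W x) (P W z) = \sum_j (v *m M) 0 j * conj (inner z (e j)).
    rewrite {1}zE /x !linear_sum inner_sumr; apply: eq_bigr => j _.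
    rewrite linearZ innerZr inner_suml mxE mulr_suml mulr_sumr.
    by apply: eq_bigr => i _; rewrite mxE linearZ innerZl mulrC.
  rewrite vM [in RHS]zE inner_sumr mulr_sumr; apply: eq_bigr => j _.
  by rewrite innerZr mxE inner_orthofam_sum// mulrCA mulrC mulrA.
rewrite mulrCA -innerZl -yE (inner_eq0C zy) mulr0 //.
Qed.

(** For an orthonormal [e], this says that [e] consists of principal vectors of its span relative to
    [W]. *)
Definition diagfam W m (e : 'I_m -> 'rV[F]_n) :=
  forall i j, i != j -> inner (P W (e i)) (P W (e j)) = 0.

Lemma exists_diagbasis W V m : \dim V = m ->
  exists e : 'I_m -> 'rV[F]_n, [/\ orthofam e, famspan e = V, diagfam W e &
    forall i j : 'I_m, (i <= j)%N -> nsq (P W (e j)) <= nsq (P W (e i))].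
Proof.
move=> dV; have [|e [se eV e1 /pairwiseP eK]] :=
    @orthobasis_ind R k n (fun x y => inner (P W x) (P W y) = 0) V.
  by move=> X _; exact: exists_compression_eigenvector.
have small (i : 'I_m) : (i < size e)%N by rewrite se dV.
(* The vectors come in no particular order; singular values must decrease. *)
have [s s_inj s_mono] := exists_sorting_perm (fun i : 'I_m => nsq (P W e`_i)).
pose f i := e`_(s i).
have both i j : i != j -> inner (f i) (f j) = 0 /\ inner (P W (f i)) (P W (f j)) = 0.
  move=> ij; have : s i != s j by rewrite (inj_eq s_inj).
  rewrite -val_eqE neq_ltn => /orP[] lt_s.
    by have /andP[/eqP/inner_eq0C-> /asboolP] := eK 0 _ _ (small _) (small _) lt_s.
  by have /andP[/eqP-> /asboolP/inner_eq0C] := eK 0 _ _ (small _) (small _) lt_s.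
have of_ : orthofam f.
  move=> i j; have [<-|/both[]//] := eqVneq i j.
  by rewrite e1// mem_nth.
exists f; split => // [|i j /both[]//].
by apply: famspan_eq => // i; apply/eV/mem_nth.
Qed.

End PrincipalVectors.

(** * Principal vectors *)

Section PrincipalVectors.
Variables (R : realType) (k : scalar_kind) (n : nat).
Local Notation F := (scalar_field R k).
Local Notation ofR := (@scalar_of_real R k).
Local Notation P := (@orthoproj R k n).
Implicit Types (U V W X : {vspace 'rV[F]_n}).

Lemma orthonormalP_pairwise (s : seq 'rV[F]_n) :
  orthonormal (@inner R k n) s <->
  {in s, forall v, inner v v = 1} /\ pairwise (fun u v => inner u v == 0) s.
Proof.
have -> : pairwise (fun u v => inner u v == 0) s = pair_ortho_rec (@inner R k n) s.
  by elim: s => //= v s ->; rewrite andbT.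
split=> [/andP[/allP s1 ->]|[s1 so]]; first by split => // v /s1/eqP.
by apply/andP; split => //; apply/allP => v /s1 v1; apply/eqP.
Qed.

Lemma orthofam_orthonormal m (e : 'I_m -> 'rV[F]_n) :
  orthofam e -> orthonormal (@inner R k n) [seq e i | i <- enum 'I_m].
Proof.
move=> oe; apply/orthonormalP_pairwise; split.
  by move=> _ /mapP[i _ ->]; rewrite oe eqxx.
rewrite pairwise_map; have := enum_uniq 'I_m; rewrite uniq_pairwise.
by apply: sub_pairwise => i j /=; rewrite oe => /negPf->.
Qed.

Lemma orthonormal_orthofam m (s : seq 'rV[F]_n) : size s = m ->
  orthonormal (@inner R k n) s -> orthofam (fun i : 'I_m => s`_i).
Proof.
move=> szs /orthonormalP_pairwise[s1 /pairwiseP so] i j.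
have small (l : 'I_m) : (l < size s)%N by rewrite szs.
case: (ltngtP i j) => ij.
- rewrite (_ : i == j = false); last by rewrite -val_eqE ltn_eqF.
  exact/eqP/(so 0 _ _ (small _) (small _) ij).
- rewrite (_ : i == j = false); last by rewrite -val_eqE gtn_eqF.
  exact/inner_eq0C/eqP/(so 0 _ _ (small _) (small _) ij).
- by rewrite (val_inj ij) eqxx s1// mem_nth.
Qed.

Lemma basis_of_famspan m (e : 'I_m -> 'rV[F]_n) V :
  orthofam e -> famspan e = V -> basis_of V [seq e i | i <- enum 'I_m].
Proof. by move=> oe eV; rewrite /basis_of orthofam_free// andbT -eV. Qed.

Lemma nth_famseq m (e : 'I_m -> 'rV[F]_n) i (im : (i < m)%N) :
  [seq e i | i <- enum 'I_m]`_i = e (Ordinal im).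
Proof.
rewrite (nth_map (Ordinal im)) ?size_enum_ord//.
by rewrite -[i in nth _ _ i]/(val (Ordinal im)) nth_ord_enum.
Qed.

(** Take a sorted principal basis [e] of [V] and the norms of its projections as singular values.
    The nonzero projections are pairwise orthogonal; normalized, they are completed to an
    orthonormal basis of [W]. *)
Lemma exists_singular_values V W : (\dim V <= \dim W)%N ->
  exists s, singular_values_of (P W) V W s.
Proof.
set m := \dim V; set q := \dim W => mq.
have [e [oe eV de e_mono]] := exists_diagbasis W (erefl m).
pose es := [seq e i | i <- enum 'I_m].
have sze : size es = m by rewrite size_map size_enum_ord.
(* As the norms decrease, the projections are nonzero exactly below the index [t]. *)
pose null x := nsq (P W x) == 0; pose t := find null es.
have tm : (t <= m)%N by rewrite -sze find_size.
have esE i (im : (i < m)%N) : es`_i = e (Ordinal im) by exact: nth_famseq.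
have ltt i : (i < t)%N -> nsq (P W es`_i) != 0.
  by move=> it; rewrite -/(null es`_i) before_find.
have get i : (t <= i)%N -> (i < m)%N -> nsq (P W es`_i) = 0.
  move=> ti im; have tm' : (t < m)%N by exact: leq_ltn_trans im.
  have /eqP t0 : null es`_t by rewrite nth_find// has_find sze.
  apply/eqP; rewrite eq_le nsq_ge0 andbT -t0 (esE _ im) (esE _ tm').
  exact: e_mono.
pose s := mkseq (fun i => Num.sqrt (nsq (P W es`_i))) m.
have sE i : (i < m)%N -> s`_i = Num.sqrt (nsq (P W es`_i)) by exact: nth_mkseq.
pose g0 (i : 'I_t) := ofR (s`_i)^-1 *: P W es`_i.
have og0 : orthofam g0.
  move=> i j; rewrite /g0 innerZl innerZr scalar_conj_real.
  have im : (i < m)%N by exact: leq_trans tm.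
  have jm : (j < m)%N by exact: leq_trans tm.
  have [->|ij] := eqVneq i j.
    rewrite inner_self -!rmorphM sE// mulrA -expr2 exprVn sqr_sqrtr ?nsq_ge0//.
    by rewrite mulVf ?rmorph1// ltt.
  by rewrite (esE _ im) (esE _ jm) de ?mulr0.
have g0W i : g0 i \in W by rewrite memvZ// mem_orthoproj.
have [b [f [tbq [of_ fE _ ogf]]]] := orthofam_extend og0 g0W (erefl q).
have gW i : famcat g0 f i \in W.
  apply: famcat_mem => // j.
  by have := mem_famspan f j; rewrite fE memv_cap => /andP[].
exists s; split.
- by rewrite size_mkseq (minn_idPl mq).
- apply/(sortedP 0) => i; rewrite size_mkseq => im.
  have im' : (i < m)%N by exact: ltnW.
  change (s`_i.+1 <= s`_i); rewrite !sE// ler_wsqrtr//.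
  rewrite (esE _ im) (esE _ im'); exact: e_mono.
- by rewrite /s /mkseq all_map; apply/allP => i _ /=; exact: sqrtr_ge0.
exists es, [seq famcat g0 f i | i <- enum 'I_(t + b)]; split.
- exact: basis_of_famspan.
- exact: orthofam_orthonormal.
- by apply: basis_of_famspan => //; apply: famspan_eq => //; rewrite tbq.
- exact: orthofam_orthonormal.
move=> i im; have [it|ti] := ltnP i t.
  have itb : (i < t + b)%N by rewrite ltn_addr.
  rewrite (nth_famseq _ itb) (_ : Ordinal itb = lshift b (Ordinal it)); last exact: val_inj.
  rewrite famcat_lshift /g0 scalerA -rmorphM divff ?rmorph1 ?scale1r//.
  by rewrite sE// sqrtr_eq0 -ltNge lt_def ltt// nsq_ge0.
have Pi := get i ti im.
by rewrite sE// Pi sqrtr0 rmorph0 scale0r; exact: nsq_eq0.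
Qed.

(** Turns the choice by [xget] into data: some sequence of singular values exists, so the chosen one
    meets its specification. The bound [s i <= 1] holds because projections do not lengthen
    vectors. *)
Lemma dg_principal V W m : \dim V = m -> (m <= \dim W)%N ->
  exists (e g : 'I_m -> 'rV[F]_n) (s : 'I_m -> R),
    [/\ orthofam e /\ famspan e = V, orthofam g /\ (forall i, g i \in W),
        forall i, 0 <= s i <= 1, forall i, P W (e i) = ofR (s i) *: g i
      & dg V W = Num.sqrt (\sum_i acos (s i) ^+ 2)].
Proof.
move=> dV mq; have ex : exists s, singular_values_of (P W) V W s.
  by apply: exists_singular_values; rewrite dV.
rewrite /dg /principal_angles dV mq; set s := xget _ _.
have [szs _ /allP s0 [e [g [be oe bg og Pe]]]] :
    singular_values_of (P W) V W s by exact: (xgetPex [::] ex).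
have sze : size e = m by rewrite -dV (size_basis (X := in_tuple e) be).
have szg : size g = \dim W by rewrite (size_basis (X := in_tuple g) bg).
have {}szs : size s = m by rewrite szs dV (minn_idPl mq).
have oe' := orthonormal_orthofam sze oe.
(* Only the first [m] vectors of the basis of [W] are kept, which makes sense as [m <= \dim W]. *)
have og' : orthofam (fun i : 'I_m => g`_i).
  move=> i j; have widen (l : 'I_m) : (l < \dim W)%N by exact: leq_trans mq.
  exact: (orthonormal_orthofam szg og (Ordinal (widen i)) (Ordinal (widen j))).
have Pe' (i : 'I_m) : P W e`_i = ofR s`_i *: g`_i by rewrite Pe// dV.
exists (fun i => e`_i), (fun i => g`_i), (fun i => s`_i); split => //.
- split=> //; apply: famspan_eq => // i.
  by apply: (basis_mem be); rewrite mem_nth ?sze.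
- by split=> // i; apply: (basis_mem bg); rewrite mem_nth// szg (leq_trans _ mq).
- move=> i; have si0 : 0 <= s`_i by apply: s0; rewrite mem_nth ?szs.
  rewrite si0 /= -(@expr_le1 _ 2)//.
  have := nsq_orthoproj_le W e`_i.
  rewrite Pe' nsqZ scalar_sqn_real (orthofam_nsq i og') mulr1.
  by rewrite (orthofam_nsq i oe').
have sumE : \sum_(t <- [seq acos x | x <- s]) t ^+ 2 = \sum_(i < m) acos s`_i ^+ 2.
  by rewrite big_map (big_nth 0) szs big_mkord.
(* The separate clause of [dg] for dimension zero agrees with the empty sum. *)
case: eqP => [m0|_]; last by rewrite sumE.
by move: (m) m0 => _ ->; rewrite big_ord0 sqrtr0.
Qed.

End PrincipalVectors.

(** * Variational characterization and triangle inequality *)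

Section Angles.
Variables (R : realType) (k : scalar_kind) (n : nat).
Local Notation F := (scalar_field R k).
Local Notation ofR := (@scalar_of_real R k).
Local Notation re := (@scalar_re R k).
Local Notation sqn := (@scalar_sqn R k).
Local Notation P := (@orthoproj R k n).
Implicit Types (U V W X : {vspace 'rV[F]_n}).

Definition ang W (v : 'rV[F]_n) : R := acos (Num.sqrt (nsq (P W v))).

Lemma ang_nsq_itv W v : nsq v = 1 -> 0 <= nsq (P W v) <= 1.
Proof. by move=> v1; rewrite nsq_ge0 -v1 nsq_orthoproj_le. Qed.

Lemma ang_sqrt_itv W v : nsq v = 1 -> 0 <= Num.sqrt (nsq (P W v)) <= 1.
Proof.
by move=> /(ang_nsq_itv W)/andP[_ le1]; rewrite sqrtr_ge0 -[leRHS]sqrtr1 ler_wsqrtr.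
Qed.

Lemma cos_ang W v : nsq v = 1 -> cos (ang W v) = Num.sqrt (nsq (P W v)).
Proof.
move=> /(ang_sqrt_itv W)/andP[c0 c1]; rewrite acosK// in_itv/= c1 andbT.
by rewrite (le_trans _ c0)// lerN10.
Qed.

Lemma ang_itv W v : nsq v = 1 -> 0 <= ang W v <= pi / 2.
Proof.
move=> /(ang_sqrt_itv W)/andP[c0 c1]; rewrite -acos0.
by rewrite acos_ge0 ?ler_acos//; lra.
Qed.

Lemma ler_ang X W v : nsq v = 1 -> nsq (P X v) <= nsq (P W v) -> ang W v <= ang X v.
Proof.
move=> v1 le_nsq; have /andP[c0 _] := ang_sqrt_itv X v1.
have /andP[_ c1] := ang_sqrt_itv W v1.
by apply: ler_acos; rewrite ?ler_wsqrtr//; lra.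
Qed.

Lemma ang_inj X W v : nsq v = 1 -> ang X v = ang W v -> nsq (P X v) = nsq (P W v).
Proof.
move=> v1 /(congr1 (@cos R)); rewrite !cos_ang// => /(congr1 (fun x => x ^+ 2)).
by rewrite !sqr_sqrtr ?nsq_ge0.
Qed.

Lemma ang_eq0 W v : nsq v = 1 -> ang W v = 0 -> v \in W.
Proof.
move=> v1 /(congr1 (@cos R)); rewrite cos_ang// cos0 => /(congr1 (fun x => x ^+ 2)).
by rewrite sqr_sqrtr ?nsq_ge0// expr1n => Pv; apply: nsq_orthoproj_eq; rewrite Pv.
Qed.

Lemma ang_mem W v : nsq v = 1 -> v \in W -> ang W v = 0.
Proof. by move=> v1 vW; rewrite /ang orthoproj_id// v1 sqrtr1 acos1. Qed.

Lemma ang_orth W v : v \in orthocompl W -> ang W v = pi / 2.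
Proof.
move=> vW; rewrite /ang (@orthoproj_unique _ _ _ W v 0) ?mem0v ?subr0//.
by rewrite /nsq inner0l raddf0 sqrtr0 acos0.
Qed.

Lemma ang_pihalf W v : nsq v = 1 -> ang W v = pi / 2 -> v \in orthocompl W.
Proof.
move=> v1 /(congr1 (@cos R)); rewrite cos_ang// cos_pihalf => /eqP.
rewrite sqrtr_eq0 => Pv; have Pv0 : nsq (P W v) = 0.
  by apply/eqP; rewrite eq_le Pv nsq_ge0.
by rewrite -[v]subr0 -(nsq_eq0 Pv0) orthoproj_residual.
Qed.

(* With [a] the cosine of the angle of [e] and [u], and [c] that of [u] and [W]:
   [c ||P_W e|| >= Re <P_W e, P_W u> >= c (a c - sqrt (1 - a^2) sqrt (1 - c^2))]. *)
Lemma ang_triangle W e u a : nsq e = 1 -> nsq u = 1 -> inner e u = ofR a -> 0 <= a ->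
  ang W e <= acos a + ang W u.
Proof.
move=> e1 u1 eu a0; set c := Num.sqrt (nsq (P W u)).
have nPu : nsq (P W u) = c ^+ 2 by rewrite sqr_sqrtr// nsq_ge0.
have /andP[c0 c1] : 0 <= c <= 1 := ang_sqrt_itv W u1.
have a1 : a <= 1.
  have := inner_cauchy_schwarz e u; rewrite e1 u1 mulr1 eu scalar_of_realK.
  by rewrite expr_le1.
have /andP[al0 al1] : 0 <= acos a <= pi / 2.
  by rewrite acos_ge0 ?[leRHS](esym (@acos0 R)) -?acos0 ?ler_acos//; lra.
have /andP[be0 be1] := ang_itv W u1.
(* If [c = 0], then [ang W u] is already [pi / 2], an upper bound for [ang W e]; otherwise [c] can
   be cancelled at the end. *)
have [cE|c_gt0] := eqVneq c 0.
  have -> : ang W u = pi / 2 by rewrite /ang -/c cE acos0.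
  by have /andP[_ h] := ang_itv W e1; lra.
have {}c_gt0 : 0 < c by rewrite lt_def c_gt0.
(* [b] and, below, [d] are the components of [e] and [P W u] orthogonal to [u]; Cauchy-Schwarz is
   applied to these two. *)
pose b := e - ofR a *: u.
have bu : inner b u = 0.
  by rewrite innerBl innerZl eu inner_self u1 rmorph1 mulr1 subrr.
have nb : nsq b = 1 - a ^+ 2.
  have : nsq e = nsq (b + ofR a *: u) by rewrite subrK.
  rewrite nsqD_orth ?innerZr ?bu ?mulr0// e1 nsqZ scalar_sqn_real u1 => ->.
  by ring.
pose d := P W u - ofR (c ^+ 2) *: u.
have uPu : inner u (P W u) = ofR (c ^+ 2).
  by rewrite -(@inner_orthoprojl _ _ _ W) ?mem_orthoproj// inner_self nPu.
have du : inner d u = 0.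
  rewrite innerBl innerZl inner_self u1 rmorph1 mulr1 innerC uPu scalar_conj_real.
  by rewrite subrr.
have nd : nsq d = c ^+ 2 * (1 - c ^+ 2).
  have : nsq (P W u) = nsq (d + ofR (c ^+ 2) *: u) by rewrite subrK.
  rewrite nsqD_orth ?innerZr ?du ?mulr0// nPu nsqZ scalar_sqn_real u1 => cE.
  by rewrite mulrBr mulr1 {1}cE; ring.
have re_bd : - (Num.sqrt (1 - a ^+ 2) * (c * Num.sqrt (1 - c ^+ 2))) <= re (inner b d).
  have : re (inner b d) ^+ 2 <= nsq b * nsq d := inner_cauchy_schwarz b d.
  rewrite -ler_sqrt ?mulr_ge0 ?nsq_ge0// sqrtr_sqr sqrtrM ?nsq_ge0// nb nd.
  rewrite sqrtrM ?sqr_ge0// sqrtr_sqr (ger0_norm c0).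
  by rewrite ler_norml => /andP[].
have rePP : re (inner (P W e) (P W u)) = a * c ^+ 2 + re (inner b d).
  rewrite inner_orthoprojl ?mem_orthoproj//.
  have -> : inner e (P W u) = ofR a * inner u (P W u) + inner b (P W u).
    by rewrite -innerZl -innerDl addrC subrK.
  have -> : inner b (P W u) = inner b d.
    by rewrite innerBr innerZr bu mulr0 subr0.
  by rewrite raddfD /= scalar_reZ uPu scalar_of_realK.
have cs : c * cos (acos a + ang W u) <= c * Num.sqrt (nsq (P W e)).
  apply: (@le_trans _ _ (re (inner (P W e) (P W u)))).
    rewrite rePP cosD acosK ?in_itv/= ?a1 ?andbT; last by lra.
    rewrite cos_ang// -/c sin_acos; last by lra.
    rewrite /ang -/c sin_acos; last by lra.
    by move: re_bd; lra.
  apply: le_trans (ler_norm _) _; rewrite -sqrtr_sqr mulrC.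
  by rewrite /c -sqrtrM ?nsq_ge0// ler_wsqrtr// inner_cauchy_schwarz.
rewrite -[leRHS]cosK; last by rewrite in_itv /=; lra.
rewrite ler_pM2l// in cs.
apply: ler_acos => //; first exact: cos_geN1.
by have /andP[] := ang_sqrt_itv W e1.
Qed.

Lemma nsq_sum_orth m (x : 'I_m -> 'rV[F]_n) (c : 'I_m -> F) :
  (forall i j, i != j -> inner (x i) (x j) = 0) ->
  nsq (\sum_i c i *: x i) = \sum_i sqn (c i) * nsq (x i).
Proof.
move=> ox; rewrite {1}/nsq inner_suml raddf_sum; apply: eq_bigr => i _.
rewrite inner_sumr (bigD1 i)//= big1 ?addr0; last first.
  by move=> j ji; rewrite innerZl innerZr ox ?mulr0// eq_sym.
by rewrite -nsqZ.
Qed.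

(** The weights [w j i], squared moduli of the coordinates of [e' j] in [e], form a doubly
    stochastic matrix. Since the [P W (e i)] are orthogonal, [nsq (P W (e' j))] is the [w j]-mean of
    the [nsq (P W (e i))]. Jensen's inequality uses the row sums, and exchanging the summations uses
    the column sums. *)
Lemma sum_sqr_ang_diag W m (e e' : 'I_m -> 'rV[F]_n) :
  orthofam e -> diagfam W e -> orthofam e' -> famspan e' = famspan e ->
  \sum_j ang W (e' j) ^+ 2 <= \sum_i ang W (e i) ^+ 2.
Proof.
move=> oe de oe' ee'; pose w j i := sqn (inner (e' j) (e i)).
have w0 j i : 0 <= w j i by exact: scalar_sqn_ge0.
have ej j : e' j \in famspan e by rewrite -ee' mem_famspan.
have wj j : \sum_i w j i = 1 by rewrite -nsq_expand// (orthofam_nsq j oe').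
have wi i : \sum_j w j i = 1.
  rewrite -(orthofam_nsq i oe) (nsq_expand oe' (v := e i)); last first.
    by rewrite ee' mem_famspan.
  by apply: eq_bigr => j _; rewrite /w innerC scalar_sqn_conj.
have Pe' j : nsq (P W (e' j)) = \sum_i w j i * nsq (P W (e i)).
  rewrite {1}(orthofam_expand oe (ej j)) linear_sum.
  under eq_bigr do rewrite linearZ.
  exact: nsq_sum_orth.
apply: (@le_trans _ _ (\sum_j \sum_i w j i * ang W (e i) ^+ 2)).
  apply: ler_sum => j _; rewrite /ang Pe'.
  apply: sqr_acos_sqrt_jensen => // i; apply: ang_nsq_itv.
  exact: orthofam_nsq.
rewrite exchange_big /=; apply: ler_sum => i _.
by rewrite -mulr_suml wi mul1r.
Qed.

(** * The distance as a maximum over orthonormal families *)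

Lemma dg_ge0 V W : 0 <= dg V W.
Proof.
rewrite /dg; case: ifP => // _; case: ifP => // _; first exact: sqrtr_ge0.
by rewrite mulr_ge0 ?sqrtr_ge0// divr_ge0// pi_ge0.
Qed.

Lemma dg_attained V W m : \dim V = m -> (m <= \dim W)%N ->
  exists e : 'I_m -> 'rV[F]_n, [/\ orthofam e, famspan e = V, diagfam W e &
    dg V W = Num.sqrt (\sum_i ang W (e i) ^+ 2)].
Proof.
move=> dV mW; have [e [g [s [[oe eV] [og gW] s01 Pe ->]]]] := dg_principal dV mW.
exists e; split => // [i j ij|].
  by rewrite !Pe innerZl innerZr og (negPf ij) !mulr0.
congr Num.sqrt; apply: eq_bigr => i _; rewrite /ang Pe nsqZ scalar_sqn_real.
have /andP[s0 _] := s01 i.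
by rewrite (orthofam_nsq i og) mulr1 sqrtr_sqr ger0_norm.
Qed.

Lemma sum_ang_famcat W a b (e : 'I_a -> 'rV[F]_n) (f : 'I_b -> 'rV[F]_n) :
  \sum_i ang W (famcat e f i) ^+ 2 =
    \sum_i ang W (e i) ^+ 2 + \sum_i ang W (f i) ^+ 2.
Proof.
rewrite big_split_ord; congr (_ + _); apply: eq_bigr => i _.
  by rewrite famcat_lshift.
by rewrite famcat_rshift.
Qed.

(** Completing [e] to a basis of [V] only adds squares, and a principal basis dominates every
    orthonormal basis. *)
Lemma dg_max V W m (e : 'I_m -> 'rV[F]_n) : (\dim V <= \dim W)%N ->
  orthofam e -> (forall i, e i \in V) -> \sum_i ang W (e i) ^+ 2 <= dg V W ^+ 2.
Proof.
move=> VW oe eV; have [b [f [mb [of_ fE ef oef]]]] := orthofam_extend oe eV (erefl (\dim V)).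
have [g [og gV dgm ->]] := dg_attained (esym mb) (leq_trans (eq_leq mb) VW).
have sum0 p (h : 'I_p -> 'rV[F]_n) : 0 <= \sum_i ang W (h i) ^+ 2.
  by apply: sumr_ge0 => i _; exact: sqr_ge0.
rewrite sqr_sqrtr//; apply: le_trans (sum_sqr_ang_diag og dgm oef _).
  by rewrite sum_ang_famcat lerDl.
rewrite gV; apply: famspan_eq => //; apply: famcat_mem => // i.
by have := mem_famspan f i; rewrite fE memv_cap => /andP[].
Qed.

Lemma dg_max_sqrt V W m (e : 'I_m -> 'rV[F]_n) : (\dim V <= \dim W)%N ->
  orthofam e -> (forall i, e i \in V) ->
  Num.sqrt (\sum_i ang W (e i) ^+ 2) <= dg V W.
Proof.
move=> VW oe eV; rewrite -[leRHS]ger0_norm ?dg_ge0// -sqrtr_sqr ler_wsqrtr//.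
exact: dg_max.
Qed.

(** Any diagonalizing basis dominates the one that attains [dg V W], so it attains it too. Distances
    can thus be computed in whichever such basis is at hand. *)
Lemma dg_diag V W m (e : 'I_m -> 'rV[F]_n) : (m <= \dim W)%N ->
  orthofam e -> famspan e = V -> diagfam W e ->
  dg V W = Num.sqrt (\sum_i ang W (e i) ^+ 2).
Proof.
move=> mW oe eV de; have dV : \dim V = m by rewrite -eV dim_famspan.
apply/eqP; rewrite eq_le dg_max_sqrt ?dV// ?andbT; last first.
  by move=> i; rewrite -eV mem_famspan.
have [g [og gV dgm ->]] := dg_attained dV mW.
by rewrite ler_wsqrtr//; apply: sum_sqr_ang_diag; rewrite ?eV.
Qed.

(* Each [e j] is matched with the image [u j] of its coordinates under the
   isometry sending the principal vectors of [V] to those of [U]; then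
   [inner (e j) (u j)] is a convex combination of cosines of principal angles. *)
Lemma exists_aligned_family V U m : \dim V = m -> (m <= \dim U)%N ->
  exists U', [/\ (U' <= U)%VS, \dim U' = m, {in V, forall v, P U v \in U'} &
    forall e : 'I_m -> 'rV[F]_n, orthofam e -> famspan e = V ->
      exists u a, [/\ orthofam u, famspan u = U',
        forall j, inner (e j) (u j) = ofR (a j) /\ 0 <= a j &
        \sum_j acos (a j) ^+ 2 <= dg V U ^+ 2]].
Proof.
move=> dV mU; have [v [u [s [[ov vV] [ou uU] s01 Pv dgE]]]] := dg_principal dV mU.
exists (famspan u); split.
- exact/famspan_subP.
- exact: dim_famspan.
- move=> x; rewrite -vV => /famspan_sum[c ->]; rewrite linear_sum memv_suml// => i _.
  by rewrite linearZ memvZ//= Pv memvZ// mem_famspan.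
move=> e oe eV; have ev j : e j \in famspan v by rewrite vV -eV mem_famspan.
pose w j i := sqn (inner (e j) (v i)).
have w0 j i : 0 <= w j i by exact: scalar_sqn_ge0.
have wj j : \sum_i w j i = 1 by rewrite -nsq_expand// (orthofam_nsq j oe).
have wi i : \sum_j w j i = 1.
  rewrite -(orthofam_nsq i ov) (nsq_expand oe (v := v i)); last first.
    by rewrite eV -vV mem_famspan.
  by apply: eq_bigr => j _; rewrite /w innerC scalar_sqn_conj.
pose u' j := \sum_i inner (e j) (v i) *: u i.
pose a j := \sum_i w j i * s i.
have ou' : orthofam u'.
  move=> j l; rewrite -oe (inner_expand ov _ (ev j)) inner_suml.
  apply: eq_bigr => i _; rewrite innerZl; congr (_ * _).
  by rewrite innerC inner_orthofam_sum.
(* As [u l] lies in [U], its product with [v i] depends only on [P U (v i) = s i u i]. *)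
have vu i l : inner (v i) (u l) = ofR (s i) * (i == l)%:R.
  by rewrite -(inner_orthoprojl (v i) (uU l)) Pv innerZl ou.
exists u', a; split => //.
- apply: famspan_eq; rewrite ?dim_famspan// => j.
  by rewrite memv_suml// => i _; rewrite memvZ// mem_famspan.
- move=> j; split; last first.
    by apply: sumr_ge0 => i _; rewrite mulr_ge0//; case/andP: (s01 i).
  rewrite /u' /a inner_sumr rmorph_sum; apply: eq_bigr => i _.
  rewrite innerZr rmorphM /= -scalar_mul_conj.
  rewrite [inner (e j) (u i)](_ : _ = inner (e j) (v i) * ofR (s i)); last first.
    rewrite {1}(orthofam_expand ov (ev j)) inner_suml (bigD1 i)//= big1.
      by rewrite addr0 innerZl vu eqxx mulr1.
    by move=> l li; rewrite innerZl vu (negPf li) !mulr0.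
  by rewrite mulrA [X in X * _]mulrC.
rewrite dgE sqr_sqrtr; last by apply: sumr_ge0 => i _; exact: sqr_ge0.
apply: (@le_trans _ _ (\sum_j \sum_i w j i * acos (s i) ^+ 2)).
  apply: ler_sum => j _; apply: sqr_acos_jensen => // i.
  by have := s01 i; lra.
rewrite exchange_big /=; apply: ler_sum => i _.
by rewrite -mulr_suml wi mul1r.
Qed.

(** Sharper than the triangle inequality: the second term involves only the part [U'] of [U]. In the
    equality case this leaves no angle for the rest of [U]. *)
Lemma dg_triangle_family V U W m : \dim V = m -> (m <= \dim U)%N -> (m <= \dim W)%N ->
  exists U', [/\ (U' <= U)%VS, \dim U' = m, {in V, forall v, P U v \in U'} &
    exists u : 'I_m -> 'rV[F]_n, [/\ orthofam u, famspan u = U' &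
      dg V W <= dg V U + Num.sqrt (\sum_j ang W (u j) ^+ 2)]].
Proof.
move=> dV mU mW; have [U' [U'U dU' PU' align]] := exists_aligned_family dV mU.
exists U'; split => //; have [e [oe eV _ ->]] := dg_attained dV mW.
have [u [a [ou uU' eu sum_a]]] := align e oe eV.
exists u; split => //.
apply: (@le_trans _ _ (Num.sqrt (\sum_j (acos (a j) + ang W (u j)) ^+ 2))).
  apply: ler_wsqrtr; apply: ler_sum => j _; have [euj aj0] := eu j.
  have /andP[a0 _] := ang_itv W (orthofam_nsq j oe).
  have ut := ang_triangle W (orthofam_nsq j oe) (orthofam_nsq j ou) euj aj0.
  by rewrite ler_pXn2r// nnegrE// (le_trans a0).
apply: le_trans (l2_triangle _ _) _; rewrite lerD2r.
by rewrite -[leRHS]ger0_norm ?dg_ge0// -sqrtr_sqr ler_wsqrtr.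
Qed.

Lemma dg_triangle V U W : (\dim V <= \dim U)%N -> (\dim U <= \dim W)%N ->
  dg V W <= dg V U + dg U W.
Proof.
move=> VU UW; have VW := leq_trans VU UW.
have [U' [/subvP U'U _ _ [u [ou uE le_dg]]]] := dg_triangle_family (erefl _) VU VW.
apply: le_trans le_dg _; rewrite lerD2l; apply: dg_max_sqrt => // j.
by apply: U'U; rewrite -uE mem_famspan.
Qed.

End Angles.

(** * Extremal values of the distance *)

Section Between.
Variables (R : realType) (k : scalar_kind) (n : nat).
Local Notation F := (scalar_field R k).
Local Notation P := (@orthoproj R k n).
Implicit Types (U V W X T S : {vspace 'rV[F]_n}).

Lemma famspan_mem m (e : 'I_m -> 'rV[F]_n) V :
  famspan e = V -> forall i, e i \in V.
Proof. by move=> <- i; exact: mem_famspan. Qed.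

(** A principal basis of [V] relative to [W] is one relative to [W'] as well, with the same
    angles. *)
Lemma dg_congr V W W' : (\dim V <= \dim W)%N -> (\dim V <= \dim W')%N ->
  {in V, forall v, P W v = P W' v} -> dg V W = dg V W'.
Proof.
move=> VW VW' PP; have [e [oe eV de ->]] := dg_attained (erefl _) VW.
have Pe i : P W (e i) = P W' (e i) by rewrite PP// -eV mem_famspan.
rewrite (dg_diag VW' oe eV) => [|i j ij]; last by rewrite -!Pe de.
by congr Num.sqrt; apply: eq_bigr => i _; rewrite /ang Pe.
Qed.

Lemma pihalf_ge0 : 0 <= pi / 2 :> R.
Proof. by rewrite divr_ge0// pi_ge0. Qed.

Lemma sqrt_sum_pihalf m :
  Num.sqrt (\sum_(i < m) (pi / 2) ^+ 2) = pi / 2 * Num.sqrt m%:R :> R.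
Proof.
rewrite sumr_const card_ord -[X in Num.sqrt X = _]mulr_natr sqrtrM ?sqr_ge0// sqrtr_sqr.
by rewrite ger0_norm// pihalf_ge0.
Qed.

Lemma dg_far V W : (\dim W < \dim V)%N \/ orthosub V W ->
  dg V W = pi / 2 * Num.sqrt (\dim V)%:R.
Proof.
have [VW|WV _] := leqP (\dim V) (\dim W); last first.
  by rewrite /dg leqNgt WV /= gtn_eqF// (leq_trans _ WV).
case=> // /orthosubP oVW; have [e [oe eV _ ->]] := dg_attained (erefl _) VW.
rewrite -sqrt_sum_pihalf; congr Num.sqrt; apply: eq_bigr => i _.
rewrite ang_orth//; apply/mem_orthocomplP => w wW; apply: oVW => //.
exact: (famspan_mem eV i).
Qed.

Lemma dg_le_far V W : dg V W <= pi / 2 * Num.sqrt (\dim V)%:R.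
Proof.
have [VW|WV] := leqP (\dim V) (\dim W); last by rewrite dg_far//; left.
have [e [oe eV _ ->]] := dg_attained (erefl _) VW.
rewrite -sqrt_sum_pihalf ler_wsqrtr//; apply: ler_sum => i _.
have /andP[a0 a1] := ang_itv W (orthofam_nsq i oe).
by rewrite ler_pXn2r// nnegrE pihalf_ge0.
Qed.

Lemma ler_sum_eq (I : finType) (f g : I -> R) : (forall i, f i <= g i) ->
  \sum_i g i <= \sum_i f i -> forall i, f i = g i.
Proof.
move=> fg gf i; apply/eqP; rewrite eq_sym -subr_eq0; apply/eqP.
move: i (isT : true); apply/(psumr_eq0P (P := xpredT)) => [i _|].
  by rewrite subr_ge0.
by apply/eqP; rewrite sumrB subr_eq0 eq_le gf ler_sum.
Qed.

(** No angle exceeds [pi / 2], so the maximal sum of squares forces each of them to equal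
    [pi / 2]. *)
Lemma dg_far_orth V W : (\dim V <= \dim W)%N ->
  dg V W = pi / 2 * Num.sqrt (\dim V)%:R -> orthosub V W.
Proof.
move=> VW; have [e [oe eV _ ->]] := dg_attained (erefl _) VW.
rewrite -sqrt_sum_pihalf => /(congr1 (fun x => x ^+ 2)).
rewrite !sqr_sqrtr ?sumr_ge0// => [sumE|i _|i _]; rewrite ?sqr_ge0//.
have le_ang i : ang W (e i) ^+ 2 <= (pi / 2) ^+ 2.
  have /andP[a0 a1] := ang_itv W (orthofam_nsq i oe).
  by rewrite ler_pXn2r// nnegrE pihalf_ge0.
have angE i : ang W (e i) = pi / 2.
  have /andP[a0 a1] := ang_itv W (orthofam_nsq i oe).
  apply/eqP; rewrite -(@eqrXn2 _ 2)// ?pihalf_ge0//; apply/eqP.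
  by move: i {a0 a1}; apply: ler_sum_eq => //; rewrite sumE.
rewrite /orthosub -[X in (X <= _)%VS]eV; apply/famspan_subP => i.
by apply: ang_pihalf (angE i); exact: orthofam_nsq.
Qed.

Lemma dg_eq0 V W : (dg V W = 0) <-> (V <= W)%VS.
Proof.
split=> [|VW].
  have [VW|WV] := leqP (\dim V) (\dim W); last first.
    rewrite dg_far => [dg0|]; last by left.
    have : 0 < pi / 2 * Num.sqrt (\dim V)%:R :> R.
      by rewrite mulr_gt0 ?divr_gt0 ?pi_gt0// sqrtr_gt0 ltr0n (leq_trans _ WV).
    by rewrite dg0 ltxx.
  have [e [oe eV _ ->]] := dg_attained (erefl _) VW => /eqP.
  rewrite sqrtr_eq0 => sum_le0.
  rewrite -[X in (X <= _)%VS]eV; apply/famspan_subP => i.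
  apply: ang_eq0; first exact: orthofam_nsq.
  apply/eqP; rewrite -sqrf_eq0 eq_sym; apply/eqP.
  by move: i; apply: ler_sum_eq => [i|]; rewrite ?sqr_ge0// big1_eq.
have [e [oe eV _ ->]] := dg_attained (erefl _) (dimvS VW).
rewrite big1 ?sqrtr0// => i _; rewrite ang_mem ?expr0n//; first exact: orthofam_nsq.
by apply: (subvP VW); exact: (famspan_mem eV i).
Qed.

(** Induction on the missing dimension, adjoining each time a unit vector of [W] orthogonal to
    [X]. *)
Lemma exists_between X W m : (X <= W)%VS -> (\dim X <= m <= \dim W)%N ->
  exists2 Y, (X <= Y <= W)%VS & \dim Y = m.
Proof.
move=> XW /andP[Xm mW].
have [d] := ubnP (m - \dim X)%N; elim: d X XW Xm => // d IH X XW Xm dX.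
have [mX|Xm'] := leqP m (\dim X).
  by exists X; rewrite ?subvv//; apply/eqP; rewrite eqn_leq Xm.
have : (0 < \dim (W :&: orthocompl X))%N.
  by have := dim_orthocompl_in XW; lia.
rewrite lt0n dimv_eq0 => /exists_unit[w]; rewrite memv_cap => /andP[wW wX] w1.
have dXw : \dim (X + <[w]>) = (\dim X).+1.
  have w0 : w != 0.
    by apply: contra_neq (oner_neq0 F) => w0; rewrite -w1 w0 inner0l.
  rewrite dimv_disjoint_sum ?dim_vline ?w0 ?addn1//; apply/eqP.
  rewrite -subv0 -(orthocompl_direct X) capvS//.
have [|||Y /andP[XY YW] dY] := IH (X + <[w]>)%VS.
- by rewrite subv_add XW.
- by rewrite dXw.
- by rewrite dXw; lia.
by exists Y; rewrite // YW (subv_trans _ XY)// addvSl.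
Qed.

Lemma dimv_lim_le (f : 'End('rV[F]_n)) X : (\dim (f @: X) <= \dim X)%N.
Proof. by rewrite -(limg_ker_dim f X) leq_addl. Qed.

(** Projecting onto the smaller [W'] shortens vectors and so widens angles; apply this to a basis
    attaining [dg V W]. *)
Lemma dg_antimono V W' W : (\dim V <= \dim W')%N -> (W' <= W)%VS -> dg V W <= dg V W'.
Proof.
move=> VW' W'W; have VW := leq_trans VW' (dimvS W'W).
have [e [oe eV _ ->]] := dg_attained (erefl _) VW.
have e1 i := orthofam_nsq i oe.
apply: le_trans (dg_max_sqrt VW' oe _); last by move=> i; exact: (famspan_mem eV i).
rewrite ler_wsqrtr//; apply: ler_sum => i _.
have /andP[a0 _] := ang_itv W (e1 i); have /andP[a0' _] := ang_itv W' (e1 i).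
rewrite ler_pXn2r// ler_ang// -(orthoproj_subK _ W'W) nsq_orthoproj_le//.
Qed.

(* The angles to [W'] dominate those to [W], so equal distances force equal
   angles for a principal basis. *)
Lemma dg_subspace_eq V W' W : (\dim V <= \dim W')%N -> (W' <= W)%VS ->
  dg V W = dg V W' -> {in V, forall v, P W v \in W'}.
Proof.
move=> VW' W'W; have VW := leq_trans VW' (dimvS W'W).
have [e [oe eV _ ->]] := dg_attained (erefl _) VW => dgE.
have e1 i := orthofam_nsq i oe.
have eVi := famspan_mem eV.
have PWe i : nsq (P W' (e i)) <= nsq (P W (e i)).
  by rewrite -(orthoproj_subK _ W'W) nsq_orthoproj_le.
have le_sqr i : ang W (e i) ^+ 2 <= ang W' (e i) ^+ 2.
  have /andP[a0 _] := ang_itv W (e1 i); have /andP[a0' _] := ang_itv W' (e1 i).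
  by rewrite ler_pXn2r// ler_ang.
have ang_eq i : ang W (e i) = ang W' (e i).
  have /andP[a0 _] := ang_itv W (e1 i); have /andP[a0' _] := ang_itv W' (e1 i).
  apply/eqP; rewrite -(@eqrXn2 _ 2)//; apply/eqP.
  move: i {a0 a0'}; apply: ler_sum_eq => //.
  have := dg_max VW' oe eVi; rewrite -dgE sqr_sqrtr// sumr_ge0// => i _.
  exact: sqr_ge0.
have Pe i : P W (e i) \in W'.
  apply: nsq_orthoproj_eq; rewrite orthoproj_subK//.
  by apply/esym/ang_inj.
move=> v vV; have /famspan_sum[c ->] : v \in famspan e by rewrite eV.
by rewrite linear_sum memv_suml// => i _; rewrite linearZ memvZ /=.
Qed.

End Between.

(** * Betweenness *)

Section Between.
Variables (R : realType) (k : scalar_kind) (n : nat).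
Local Notation F := (scalar_field R k).
Local Notation P := (@orthoproj R k n).
Implicit Types (U V W X T S : {vspace 'rV[F]_n}).

Lemma orthosub_sym V W : orthosub V W = orthosub W V.
Proof. exact: orthov_sym. Qed.

Lemma orthoproj_sub_mem X W v : (X <= W)%VS -> P W v \in X -> P X v = P W v.
Proof. by move=> XW PX; rewrite -(orthoproj_subK _ XW) orthoproj_id. Qed.

(** An orthonormal basis of [U'] is an orthonormal family in [U], over which [dg U W] is a
    maximum. *)
Lemma dg_mono U' U W : (U' <= U)%VS -> (\dim U <= \dim W)%N -> dg U' W <= dg U W.
Proof.
move=> U'U UW; have U'W := leq_trans (dimvS U'U) UW.
have [e [oe eU' _ ->]] := dg_attained (erefl _) U'W.
by apply: dg_max_sqrt => // i; apply: (subvP U'U); exact: (famspan_mem eU' i).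
Qed.

Lemma add_le_eq0 (a c : R) : a + c <= a -> 0 <= c -> c = 0.
Proof. by move=> ? ?; lra. Qed.

Lemma squeeze_sum (a a' b c c' : R) :
  a = b + c -> a <= a' -> a' <= b + c' -> c' <= c -> a = a' /\ a' = b + c'.
Proof. by move=> -> ? ? ?; split; lra. Qed.

Lemma dg_segment_decomp V U W (p : nat) : \dim V = p -> (p <= \dim U <= \dim W)%N ->
  dg V W = dg V U + dg U W ->
  exists U' W' S T : {vspace 'rV[F]_n},
    [/\ is_orthosum U U' S /\ is_orthosum W W' T,
        [/\ V \in Grp p (orthocompl T), U' \in Grp p (orthocompl T)
          & W' \in Grp p (orthocompl T)],
        (S <= T)%VS & U' \in dg_segment V W'].
Proof.
move=> dV /andP[pU UW] dgE; have pW := leq_trans pU UW.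
have [U' [U'U dU' PU' [u [ou uU' le_dg]]]] := dg_triangle_family dV pU pW.
pose S := (U :&: orthocompl U')%VS.
have S_orth : {in U' & S, forall x y, inner x y = 0}.
  move=> x y xU'; rewrite memv_cap => /andP[_ /mem_orthocomplP yU'].
  by apply: inner_eq0C; exact: yU'.
have SW : (S <= W)%VS.
  have uU i : u i \in U by apply: (subvP U'U); exact: (famspan_mem uU' i).
  (* Here [f] is a basis of [S]. The squared angles of [u] and [f] together sum to at most
     [dg U W ^ 2], while the segment equality bounds [dg U W ^ 2] by the share of [u]; so every
     [f i] has angle zero with [W]. *)
  have [b [f [_ [of_ fE _ ouf]]]] := orthofam_extend ou uU (erefl (\dim U)).
  have fU i : f i \in U.
    by have := mem_famspan f i; rewrite fE memv_cap => /andP[].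
  have := dg_max UW ouf (famcat_mem uU fU); rewrite sum_ang_famcat => max_dg.
  rewrite dgE lerD2l in le_dg.
  have sum0 : 0 <= \sum_j ang W (u j) ^+ 2.
    by apply: sumr_ge0 => i _; exact: sqr_ge0.
  have : dg U W ^+ 2 <= \sum_j ang W (u j) ^+ 2.
    by rewrite -[leRHS]sqr_sqrtr// ler_pXn2r ?nnegrE ?dg_ge0 ?sqrtr_ge0.
  move=> dg_le; have sum_le0 : \sum_i ang W (f i) ^+ 2 <= 0.
    by rewrite -(lerD2l (\sum_j ang W (u j) ^+ 2)) addr0 (le_trans max_dg).
  rewrite /S -uU' -fE; apply/famspan_subP => i.
  apply: ang_eq0; first exact: orthofam_nsq.
  apply/eqP; rewrite -sqrf_eq0 eq_sym; apply/eqP.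
  by move: i; apply: ler_sum_eq => [i|]; rewrite ?sqr_ge0// big1_eq.
pose B := (W :&: orthocompl S)%VS.
have PB : (P W @: U' <= B)%VS.
  apply/subvP => _ /memv_imgP[x xU' ->]; rewrite memv_cap mem_orthoproj /=.
  apply/mem_orthocomplP => y yS; rewrite inner_orthoprojl ?(subvP SW)//.
  exact: S_orth.
(* There is room for [W'] in [B]: [dim B = dim W - dim S >= dim U - dim S = p], and the image of
   [U'] has dimension at most [p]. *)
have [|W' /andP[PW' W'B] dW'] := exists_between (m := p) PB.
  have := dim_orthocompl_in SW; have := dim_orthocompl_in U'U.
  have := dimv_lim_le (P W) U'; rewrite dU' => -> dUE dWE.
  by rewrite -(leq_add2l (\dim S)) dWE addnC dUE.
have W'W : (W' <= W)%VS by rewrite (subv_trans W'B)// capvSl.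
have PWU' : {in U', forall x, P W x \in W'}.
  by move=> x xU'; apply: (subvP PW'); exact: memv_img.
(* [P U] maps [V] into [U'] and [P W] maps [U'] into [W'], so shrinking these targets changes
   neither distance. *)
have dgVU : dg V U = dg V U'.
  apply: dg_congr => [||v vV]; [by rewrite dV|by rewrite dV dU'|].
  by rewrite (orthoproj_sub_mem U'U (PU' v vV)).
have dgU'W : dg U' W = dg U' W'.
  apply: dg_congr => [||x xU']; [by rewrite dU'|by rewrite dU' dW'|].
  by rewrite (orthoproj_sub_mem W'W (PWU' x xU')).
have VW' : (\dim V <= \dim W')%N by rewrite dV dW'.
have dgVW : dg V W <= dg V W' by exact: dg_antimono.
have dgVW' : dg V W' <= dg V U' + dg U' W' by apply: dg_triangle; rewrite ?dV ?dU' ?dW'.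
have := dg_mono U'U UW; rewrite dgU'W => dgUW.
rewrite -dgVU in dgVW'; have [dgVWE seg] := squeeze_sum dgE dgVW dgVW' dgUW.
have PWV := dg_subspace_eq VW' W'W dgVWE.
pose T := (W :&: orthocompl W')%VS.
(* For [t] in [T], a part of [W], the product of [x] with [t] is that of [P W x] with [t]. This one
   criterion serves [V], [U'] and [W']. *)
have T_orth x : P W x \in W' -> x \in orthocompl T.
  move=> Px; apply/mem_orthocomplP => t; rewrite memv_cap => /andP[tW tW'].
  rewrite -(inner_orthoprojl _ tW); apply: inner_eq0C.
  by move/mem_orthocomplP: tW'; apply.
exists U', W', S, T; split.
- split; split.
  + by rewrite orthocompl_decomp.
  + exact/orthosubP.
  + by rewrite orthocompl_decomp.
  + by rewrite orthosub_sym; exact: capvSr.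
- split; apply/mem_set.
  + by split; [exact: dV | apply/subvP => x /PWV/T_orth].
  + by split; [exact: dU' | apply/subvP => x /PWU'/T_orth].
  + split; [exact: dW' | apply/subvP => x xW'; apply: T_orth].
    by rewrite (orthoproj_id (subvP W'W _ xW')).
- rewrite /T subv_cap SW /= -/(orthosub S W') orthosub_sym.
  exact: subv_trans W'B (capvSr _ _).
- by apply/mem_set; rewrite /dg_segment /= -dgVU.
Qed.

(** Vectors orthogonal to [T] project onto [W] and [U] as onto [W'] and [U'], and [S], lying in [W],
    adds only zero angles to [dg U W]. All three distances thus reduce to those among [V], [U'] and
    [W']. *)
Lemma dg_segment_orthosum V U W U' W' S T p :
  is_orthosum U U' S -> is_orthosum W W' T ->
  V \in Grp p (orthocompl T) -> U' \in Grp p (orthocompl T) ->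
  W' \in Grp p (orthocompl T) -> (S <= T)%VS -> U' \in dg_segment V W' ->
  (\dim U <= \dim W)%N -> dg V W = dg V U + dg U W.
Proof.
move=> [UE oUS] [WE oWT] /set_mem[dV VT] /set_mem[dU' U'T] /set_mem[dW' W'T] ST.
move=> /set_mem seg UW.
have U'U : (U' <= U)%VS by rewrite UE addvSl.
have W'W : (W' <= W)%VS by rewrite WE addvSl.
have TW : (T <= W)%VS by rewrite WE addvSr.
(* The summand [Z] of an orthogonal sum contributes nothing to the projection of a vector orthogonal
   to [Z]. *)
have proj_eq X X' Z x : X = (X' + Z)%VS -> orthosub X' Z ->
    x \in orthocompl Z -> P X x = P X' x.
  move=> -> oXZ xZ; apply: orthoproj_unique.
    by rewrite (subvP (addvSl X' Z))// mem_orthoproj.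
  apply/mem_orthocomplP => _ /memv_addP[y yX [z zZ ->]].
  rewrite innerDr innerBl inner_orthoprojl// subrr add0r innerBl.
  move/mem_orthocomplP: xZ => ->//; rewrite sub0r.
  by move/orthosubP: oXZ => ->; rewrite ?oppr0 ?mem_orthoproj.
have toS X x : (X <= orthocompl T)%VS -> x \in X -> x \in orthocompl S.
  move=> XT /(subvP XT)/mem_orthocomplP xT.
  by apply/mem_orthocomplP => s /(subvP ST)/xT.
have toT X x : (X <= orthocompl T)%VS -> x \in X -> x \in orthocompl T.
  by move=> XT /(subvP XT).
have dgVW : dg V W = dg V W'.
  apply: dg_congr => [||v vV]; [by rewrite dV -dW' dimvS|by rewrite dV dW'|].
  by apply: proj_eq WE oWT _; apply: toT vV.
have dgVU : dg V U = dg V U'.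
  apply: dg_congr => [||v vV]; [by rewrite dV -dU' dimvS|by rewrite dV dU'|].
  by apply: proj_eq UE oUS _; apply: toS vV.
have PW' x : x \in U' -> P W x = P W' x.
  by move=> xU'; apply: proj_eq WE oWT _; apply: toT xU'.
suff dgUW : dg U W = dg U' W' by rewrite dgVW dgVU dgUW.
have [e [oe eU' de ->]] := dg_attained dU' (eq_leq (esym dW')).
have [f of_ fS] := exists_orthobasis (erefl (\dim S)).
have eU'i i := famspan_mem eU' i; have fSi i := famspan_mem fS i.
have PWe i : P W (e i) = P W' (e i) by exact: PW'.
have PWf i : P W (f i) = f i.
  by apply/orthoproj_id/(subvP TW)/(subvP ST).
have W'f x j : x \in W' -> inner x (f j) = 0.
  by move=> xW'; exact: (orthosubP _ _ oWT) xW' (subvP ST _ (fSi j)).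
have oef : orthofam (famcat e f).
  by apply: orthofam_cat oe of_ _ => i j; exact: (orthosubP _ _ oUS).
have dimU : (p + \dim S)%N = \dim U.
  have US0 : (U' :&: S = 0)%VS.
    by apply/eqP; rewrite -subv0 -(orthocompl_direct S) capvC capvS.
  by rewrite UE (dimv_disjoint_sum US0) dU'.
(* The [e i] project into [W'] and the [f i] are fixed in [T], so mixed products vanish and the
   joined basis of [U] is still principal. *)
have def_ : diagfam W (famcat e f).
  move=> i j; case: (split_ordP i) => i' ->; case: (split_ordP j) => j' ->.
  - by rewrite eq_lshift !famcat_lshift !PWe; exact: de.
  - by move=> _; rewrite famcat_lshift famcat_rshift PWe PWf (W'f _ _ (mem_orthoproj _ _)).
  - move=> _; rewrite famcat_lshift famcat_rshift PWe PWf; apply: inner_eq0C.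
    by rewrite (W'f _ _ (mem_orthoproj _ _)).
  - by rewrite eq_rshift !famcat_rshift !PWf of_ => /negPf->.
have ef_mW : (p + \dim S <= \dim W)%N by rewrite dimU.
have ef_span : famspan (famcat e f) = U.
  apply: (famspan_eq oef); last exact/esym/dimU.
  apply: famcat_mem => i; first exact: (subvP U'U _ (eU'i i)).
  by rewrite UE; exact: (subvP (addvSr _ _) _ (fSi i)).
rewrite (dg_diag ef_mW oef ef_span def_) sum_ang_famcat.
rewrite [X in _ + X]big1 ?addr0; last first.
  move=> i _; have fW := subvP TW _ (subvP ST _ (fSi i)).
  by rewrite (ang_mem (orthofam_nsq i of_) fW) expr0n.
by congr Num.sqrt; apply: eq_bigr => i _; rewrite /ang PWe.
Qed.

End Between.

(** * Segments of the asymmetric metric, by comparison of dimensions *)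

Theorem proposition4p33 (R : realType) (k : scalar_kind) (n : nat)
    (U V W : {vspace 'rV[scalar_field R k]_n}) (p q r : nat)
    (dimU : \dim U = r) (dimV : \dim V = p) (dimW : \dim W = q)
    (neqUV : U <> V) (neqUW : U <> W) (neqVW : V <> W) :
  U \in dg_between V W <->
    ((p <= r <= q)%N /\
     exists U' W' S T : {vspace 'rV[scalar_field R k]_n},
       [/\ is_orthosum U U' S /\ is_orthosum W W' T,
           [/\ V \in Grp p (orthocompl T), U' \in Grp p (orthocompl T)
             & W' \in Grp p (orthocompl T)],
           (S <= T)%VS
         & U' \in dg_segment V W'])
    \/ ((U <= W)%VS /\ (orthosub V W \/ (q < p)%N)).
Proof.
have pi_gt : 0 < pi / 2 :> R by rewrite divr_gt0// pi_gt0.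
have between : U \in dg_between V W <-> dg V W = dg V U + dg U W.
  split=> [/set_mem[]//|seg]; apply/mem_set; split => //.
  by case=> [/neqUV|/neqUW].
have lt_sqrt a b : (a < b)%N -> pi / 2 * Num.sqrt a%:R < pi / 2 * Num.sqrt b%:R :> R.
  by move=> ab; rewrite ltr_pM2l// ltr_sqrt ?ltr_nat// ltr0n (leq_trans _ ab).
rewrite between; split=> [seg|[[prq [U' [W' [S [T [[oU oW] [VT U'T W'T] ST seg]]]]]]|[UW VW]]].
(* For [q < r], [dg U W] is [pi / 2 * sqrt r]. If [r < p], then [dg V U] alone reaches the upper
   bound of [dg V W], so [dg U W = 0]; if [p < r], then [dg U W] exceeds that bound; if [r = p],
   then [dg V U = 0] and [U = V]. *)
- have [rq|qr] := leqP r q; last first.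
    have dUW : dg U W = pi / 2 * Num.sqrt r%:R.
      by rewrite dg_far dimU ?dimW//; left.
    have dVW := dg_le_far V W; rewrite dimV in dVW.
    have [rp|pr|pr] := ltngtP r p.
    + have dVU : dg V U = pi / 2 * Num.sqrt p%:R.
        by rewrite dg_far dimV ?dimU//; left.
      have dUW0 : dg U W = 0.
        apply: (@add_le_eq0 _ (dg V U)) (dg_ge0 U W).
        by rewrite -seg dVU.
      by right; split; [exact/dg_eq0 | right; exact: ltn_trans rp].
    + have := lt_sqrt _ _ pr; rewrite -dUW => /(le_lt_trans dVW).
      by rewrite seg ltNge lerDr dg_ge0.
    + have dVU0 : dg V U = 0.
        apply: (@add_le_eq0 _ (dg U W)) (dg_ge0 V U).
        by rewrite addrC -seg dUW pr.
      case: neqUV; apply/eqP; rewrite eq_sym eqEdim dimU dimV pr leqnn andbT.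
      exact/dg_eq0.
  have [pr|rp] := leqP p r.
    left; split=> //; apply: dg_segment_decomp => //.
    by rewrite dimU dimW pr.
  (* For [r < p], [dg V U] is the largest value [dg V W] can take. So [dg U W = 0] and [dg V W] is
     maximal, which for [p <= q] means orthogonality. *)
  have dVU : dg V U = pi / 2 * Num.sqrt p%:R.
    by rewrite dg_far dimV ?dimU//; left.
  have dVW := dg_le_far V W; rewrite dimV in dVW.
  have dUW0 : dg U W = 0.
    apply: (@add_le_eq0 _ (dg V U)) (dg_ge0 U W).
    by rewrite -seg dVU.
  right; split; first exact/dg_eq0.
  have [pq|qp] := leqP p q; [left|by right].
  apply: dg_far_orth; first by rewrite dimV dimW.
  by rewrite seg dVU dUW0 addr0 dimV.
- apply: (dg_segment_orthosum oU oW VT U'T W'T ST seg).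
  by rewrite dimU dimW; case/andP: prq.
(* With [dg U W = 0], it remains that [dg V W] and [dg V U] both equal [pi / 2 * sqrt p]:
   orthogonality to [W] passes to [U], and [q < p] gives [r < p]. *)
have /dg_eq0-> := UW; rewrite addr0.
have UWd : (r <= q)%N by rewrite -dimU -dimW dimvS.
rewrite !dg_far//.
  case: VW => [VW|qp]; last by left; rewrite dimU dimV (leq_ltn_trans UWd).
  right; apply/orthosubP => x y xV yU.
  by move/orthosubP: VW; apply=> //; exact: (subvP UW).
by case: VW => [|qp]; [right | left; rewrite dimV dimW].
Qed.
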